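(* Let $[F,F]$ be the commutator subgroup of Thompson's group $F$ and let $u\in H^2([F,F];\mathbf{R})$ be the class represented by the cocycle $\alpha$. For every positive integer $n$ there exists an injective homomorphism $\psi\colon\mathbf{Z}^{2n}\to[F,F]$ such that $\psi^*(u^n)\ne0$ in $H^{2n}(\mathbf{Z}^{2n};\mathbf{R})$. Consequently, $u^n\in H^{2n}([F,F];\mathbf{R})$ cannot be represented by a 1-bounded cocycle.
   Context: Thompson's group $F$ is the group (under composition) of orientation-preserving piecewise linear homeomorphisms of $[0,1]$ with finitely many breakpoints, all at dyadic rationals, and with all slopes integral powers of $2$. Write $F'=[F,F]$. The cocycle $\alpha\colon F'\times F'\to\mathbf{R}$ (of Ghys and Sergiescu) is $$\alpha(f,g)=\sum_x\det\begin{pmatrix}\log_2 g'_L(x)&\log_2(f\circ g)'_L(x)\\ \log_2 g'_R(x)&\log_2(f\circ g)'_R(x)\end{pmatrix},$$ where the sum is over the breakpoints (only finitely many $x$ contribute) and the subscripts $L,R$ denote left and right derivatives. The class $u=[\alpha]$ generates the cohomology ring $H^*(F';\mathbf{R})\cong\mathbf{R}[u]$, $\deg u=2$; $u^n$ is the $n$-fold cup power. Group cohomology is computed with nonhomogeneous cochains $\omega\colon\Gamma^m\to\mathbf{R}$ (trivial coefficients). For $m\ge1$, an $m$-cochain $\omega$ is 1-bounded if for all fixed $g_2,\dots,g_m\in\Gamma$ the function $g_1\mapsto\omega(g_1,g_2,\dots,g_m)$ is bounded. *)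

(* Defs.v *)
From HB Require Import structures.
From mathcomp Require Import all_boot all_order all_algebra zify ring lra.
From mathcomp Require Import all_classical all_reals all_analysis.

Set Implicit Arguments.
Unset Strict Implicit.
Unset Printing Implicit Defensive.

Import Order.TTheory GRing.Theory Num.Theory.
Import numFieldNormedType.Exports.

Local Open Scope ring_scope.

Definition cochain (G : groupType) (R : comNzRingType) (m : nat) : Type :=
  ('I_m -> G) -> R.

HB.instance Definition _ G R m := GRing.Zmodule.on (cochain G R m).

Section Cochain.
Variables (G : groupType) (R : comNzRingType).
Implicit Types m k : nat.

(* With entries numbered from 0, the tuple
   (g 0, ..., g (i - 1), g i * g (i + 1), g (i + 2), ..., g m). *)
Definition merge_at m (i : 'I_m) (g : 'I_m.+1 -> G) : 'I_m -> G := fun j =>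
  if (j < i)%N then g (lift ord_max j)
  else if j == i then (g (lift ord_max j) * g (lift ord0 j))%g
  else g (lift ord0 j).

(* The nonhomogeneous coboundary
   (dw)(g_1, ..., g_(m+1)) = w(g_2, ..., g_(m+1))
     + sum_(1 <= i <= m) (-1)^i w(g_1, ..., g_i g_(i+1), ..., g_(m+1))
     + (-1)^(m+1) w(g_1, ..., g_m). *)
Definition cobd m (w : cochain G R m) : cochain G R m.+1 := fun g =>
  w (g \o lift ord0) + \sum_(i < m) (-1) ^+ i.+1 * w (merge_at i g)
  + (-1) ^+ m.+1 * w (g \o lift ord_max).

Definition coboundary m : cochain G R m -> Prop :=
  match m with
  | 0 => fun w => w = 0
  | m'.+1 => fun w => exists b : cochain G R m', w = cobd b
  end.

Definition cup_cochain m k (w : cochain G R m) (v : cochain G R k) :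
    cochain G R (m + k) :=
  fun g => w (g \o @lshift m k) * v (g \o @rshift m k).

Lemma diffB m (w v : cochain G R m) : cobd (w - v) = cobd w - cobd v.
Proof.
apply/funext => g; rewrite -[RHS]/(cobd w g - cobd v g) /cobd.
have E h : (w - v : cochain G R m) h = w h - v h by [].
under eq_bigr do rewrite E mulrBr.
rewrite !E sumrB; ring.
Qed.

Lemma diff0 m : cobd (0 : cochain G R m) = 0.
Proof. by rewrite -(subrr 0) diffB !subrr. Qed.

Lemma eq_arg m (w : cochain G R m) (g h : 'I_m -> G) : g =1 h -> w g = w h.
Proof. by move=> /funext ->. Qed.

Lemma diff_cup m k (w : cochain G R m) (v : cochain G R k)
    (g : 'I_(m + k).+1 -> G) :
  cobd (cup_cochain w v) g =
    cobd w (g \o (@lshift m.+1 k : 'I_m.+1 -> 'I_(m + k).+1)) *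
      v (g \o (@rshift m.+1 k : 'I_k -> 'I_(m + k).+1)) +
    (-1) ^+ m * (w (g \o lift ord_max \o @lshift m k) *
      cobd v (g \o cast_ord (addnS m k) \o @rshift m k.+1)).
Proof.
have ordE (i j : 'I_(m + k).+1) : i = j :> nat -> g i = g j.
  by move=> ij; congr g; exact: val_inj.
have bump0 j : bump 0 j = j.+1 by [].
have bumpl i j : (j < i)%N -> bump i j = j by rewrite /bump; case: leqP.
set g1 := (g \o (@lshift m.+1 k : 'I_m.+1 -> 'I_(m + k).+1)).
set g2 := (g \o cast_ord (addnS m k) \o @rshift m k.+1).
set V := v (_ \o @rshift m.+1 k).
set W := w (_ \o @lshift m k).
have hd : w ((g \o lift ord0) \o @lshift m k) *
          v ((g \o lift ord0) \o @rshift m k) = w (g1 \o lift ord0) * V.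
  by congr (w _ * v _); apply/funext => j /=; apply: ordE;
    rewrite /= ?bump0 ?bumpl; lia.
have tl : w ((g \o lift ord_max) \o @lshift m k) *
          v ((g \o lift ord_max) \o @rshift m k) = W * v (g2 \o lift ord_max).
  rewrite -/W; congr (_ * v _); apply/funext => j /=; apply: ordE => /=.
  by have jk := ltn_ord j; rewrite ?bumpl; lia.
have md1 (i : 'I_m) : w (merge_at (lshift k i) g \o @lshift m k) *
    v (merge_at (lshift k i) g \o @rshift m k) = w (merge_at i g1) * V.
  have im := ltn_ord i.
  congr (w _ * v _); apply/funext => j; have jm := ltn_ord j.
    rewrite /merge_at /= eq_shift.
    case: ifP => _; last case: ifP => _; do ?congr (_ * _)%g; apply: ordE;
      rewrite /= ?bump0 ?bumpl; lia.
  rewrite /merge_at /= eq_shift.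
  by rewrite ifN /=; [apply: ordE; rewrite /= ?bump0 ?bumpl; lia | lia].
have md2 (i : 'I_k) : w (merge_at (rshift m i) g \o @lshift m k) *
    v (merge_at (rshift m i) g \o @rshift m k) = W * v (merge_at i g2).
  have ik := ltn_ord i.
  congr (w _ * v _); apply/funext => j; have jm := ltn_ord j.
    by rewrite /merge_at /= ifT //; lia.
  rewrite /merge_at /= eq_shift ltn_add2l.
  case: ifP => _; last case: ifP => _; do ?congr (_ * _)%g; apply: ordE;
    rewrite /= ?bump0 ?bumpl; lia.
have mid : w (g1 \o lift ord_max) = W.
  apply: eq_arg => j /=; apply: ordE; have jm : (j < m)%N := ltn_ord j.
  by rewrite /= ?bumpl ?ltn_addr.
have mid' : v (g2 \o lift ord0) = V.
  by apply: eq_arg => j /=; apply: ordE; rewrite /= ?bump0 ?bumpl; lia.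
rewrite /cobd /cup_cochain big_split_ord /= hd tl mid mid'.
under eq_bigr do rewrite md1 mulrA.
under [X in _ + (_ + X) + _]eq_bigr => i _.
  rewrite md2 -addnS exprD mulrCA -!mulrA mulrCA.
over.
rewrite -mulr_suml -!mulr_sumr -addnS exprD (exprS _ k) (exprS _ m); ring.
Qed.


Lemma diffZ m (a : R) (w : cochain G R m) :
  cobd (fun g => a * w g) = (fun g => a * cobd w g) :> cochain G R m.+1.
Proof.
apply/funext => g; rewrite /cobd !mulrDr mulr_sumr.
by congr (_ + _ + _); [apply: eq_bigr => i _|]; rewrite mulrCA.
Qed.

Lemma coboundary0 m : coboundary (0 : cochain G R m).
Proof. by case: m => //= m; exists 0; rewrite diff0. Qed.

Lemma coboundaryB m (w v : cochain G R m) :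
  coboundary w -> coboundary v -> coboundary (w - v).
Proof.
case: m w v => [|m] w v /=; first by move=> -> ->; rewrite subrr.
by move=> [a ->] [b ->]; exists (a - b); rewrite diffB.
Qed.

Lemma cup_cocycle_subproof m k (w : cochain G R m) (v : cochain G R k) :
  cobd w = 0 -> cobd v = 0 -> cobd (cup_cochain w v) = 0.
Proof.
by move=> w0 v0; apply/funext => g; rewrite diff_cup w0 v0 mul0r !mulr0 addr0.
Qed.

Lemma cup_coboundaryl m k (w : cochain G R m) (v : cochain G R k) :
  coboundary w -> cobd v = 0 -> coboundary (cup_cochain w v).
Proof.
case: m w => [|m] w /=.
  move=> -> _; rewrite (_ : cup_cochain _ _ = 0); first exact: coboundary0.
  by apply/funext => g; rewrite /cup_cochain mul0r.
move=> [b ->] v0; exists (cup_cochain b v); apply/funext => g.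
by rewrite diff_cup v0 !mulr0 addr0.
Qed.

Lemma coboundary_cast m m' (e : m = m') (w : cochain G R m) :
  coboundary ((fun g => w (g \o cast_ord e)) : cochain G R m') -> coboundary w.
Proof.
case: m' / e; congr coboundary; apply/funext => g.
by apply: eq_arg => i /=; rewrite cast_ord_id.
Qed.

Lemma cup_coboundaryr m k (w : cochain G R m) (v : cochain G R k) :
  cobd w = 0 -> coboundary v -> coboundary (cup_cochain w v).
Proof.
case: k v => [|k] v w0 /=.
  move=> ->; rewrite (_ : cup_cochain _ _ = 0); first exact: coboundary0.
  by apply/funext => g; rewrite /cup_cochain mulr0.
move=> [b ->]; apply: (@coboundary_cast _ _ (addnS m k)).
exists (fun g => (-1) ^+ m * cup_cochain w b g).
rewrite diffZ; apply/funext => g.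
rewrite diff_cup w0 mul0r add0r mulrA -exprD addnn -mul2n exprM sqrrN !expr1n.
rewrite mul1r; congr (w _ * _); apply/funext => i /=; congr g; apply: val_inj.
by rewrite /= /bump leqNgt ltn_addr.
Qed.
End Cochain.

Section Cohomology.
Variables (G : groupType) (R : comNzRingType).
Implicit Types m k : nat.

Record cocycle m := Cocycle {
  cocycle_cochain :> cochain G R m;
  cocycleP : cobd cocycle_cochain == 0
}.

HB.instance Definition _ m := [isSub for @cocycle_cochain m].
HB.instance Definition _ m := [Choice of cocycle m by <:].

Fact cocycle_zmod_closed m :
  zmod_closed [pred w : cochain G R m | cobd w == 0].
Proof.
split=> [|w v w0 v0]; apply/eqP; first exact: diff0.
by rewrite diffB (eqP w0) (eqP v0) subrr.
Qed.

HB.instance Definition _ m := GRing.SubChoice_isSubZmodule.Build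
  (cochain G R m) [pred w | cobd w == 0] (cocycle m) (@cocycle_zmod_closed m).

Definition bounding m : {pred cocycle m} := fun w => `[< coboundary w >].

Fact bounding_zmod_closed m : zmod_closed (@bounding m).
Proof.
split=> [|w v /asboolP hw /asboolP hv]; apply/asboolP.
  exact: coboundary0.
exact: coboundaryB.
Qed.

HB.instance Definition _ m :=
  GRing.isZmodClosed.Build (cocycle m) (@bounding m) (@bounding_zmod_closed m).

(* H^m(G; R), a quotient of abelian groups. *)
Definition cohomology m := {ideal_quot (@bounding m)}.

HB.instance Definition _ m := GRing.Zmodule.on (cohomology m).

Definition cohom_class m (w : cocycle m) : cohomology m :=
  \pi_({ideal_quot (@bounding m)})%qT w.

Definition one_cocycle_def : cochain G R 0 := fun=> 1.

Fact one_cocycle_subproof : cobd one_cocycle_def == 0.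
Proof. by apply/eqP/funext => g; rewrite /cobd big_ord0 addr0 mulr1 subrr. Qed.

Definition one_cocycle : cocycle 0 := Cocycle one_cocycle_subproof.

Definition cup_cocycle m k (w : cocycle m) (v : cocycle k) : cocycle (m + k) :=
  Cocycle (introT eqP
    (cup_cocycle_subproof (eqP (cocycleP w)) (eqP (cocycleP v)))).

(* Independence of the representatives is cupE. *)
Definition cup m k (x : cohomology m) (y : cohomology k) : cohomology (m + k) :=
  cohom_class (cup_cocycle (repr x) (repr y)).

(* The n-fold cup power lives in degree n * m, which unfolds to the degree
   m + n' * m of the cup product below when n = n'.+1. *)
Fixpoint cup_pow m (x : cohomology m) (n : nat) : cohomology (n * m) :=
  match n with
  | 0 => cohom_class one_cocycle
  | n'.+1 => cup x (cup_pow x n')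
  end.

Lemma cohom_class_eqP m (w v : cocycle m) :
  cohom_class w = cohom_class v <-> coboundary (w - v : cochain G R m).
Proof.
split=> [/eqP|h].
  by rewrite -Quotient.idealrBE => /asboolP.
by apply/eqP; rewrite -Quotient.idealrBE; apply/asboolP.
Qed.

Lemma cupE m k (w : cocycle m) (v : cocycle k) :
  cup (cohom_class w) (cohom_class v) = cohom_class (cup_cocycle w v).
Proof.
set w' : cocycle m := repr (cohom_class w).
set v' : cocycle k := repr (cohom_class v).
have /cohom_class_eqP hw : cohom_class w' = cohom_class w by exact: reprK.
have /cohom_class_eqP hv : cohom_class v' = cohom_class v by exact: reprK.
apply/cohom_class_eqP; rewrite -/w' -/v' /=.
have -> : cup_cochain w' v' - cup_cochain w v =
    cup_cochain (w' - w : cochain G R m) v' -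
    cup_cochain w (v - v' : cochain G R k).
  apply/funext => g.
  rewrite -[LHS]/(cup_cochain w' v' g - cup_cochain w v g).
  rewrite -[RHS]/(cup_cochain (w' - w : cochain G R m) v' g -
    cup_cochain w (v - v' : cochain G R k) g) /cup_cochain.
  rewrite -[X in _ = X * _ - _]/(cocycle_cochain w' _ - cocycle_cochain w _).
  rewrite -[X in _ = _ - _ * X]/(cocycle_cochain v _ - cocycle_cochain v' _).
  ring.
apply: coboundaryB.
  by apply: cup_coboundaryl => //; exact/eqP/cocycleP.
apply: cup_coboundaryr; first exact/eqP/cocycleP.
by rewrite -[_ - _]opprB -[- _]sub0r; apply: coboundaryB (coboundary0 _ _ _) _.
Qed.

End Cohomology.

Section Pullback.
Variables (G H : groupType) (R : comNzRingType) (psi : {multiplicative G -> H}).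
Implicit Types m : nat.

Definition pullback_cochain m (w : cochain H R m) : cochain G R m :=
  fun g => w (psi \o g).

Lemma diff_pullback m (w : cochain H R m) :
  cobd (pullback_cochain w) = pullback_cochain (cobd w).
Proof.
apply/funext => g; rewrite /pullback_cochain /cobd; congr (_ + _ + _).
apply: eq_bigr => i _; congr (_ * w _); apply/funext => j.
by rewrite /merge_at /=; case: ifP => // _; case: ifP => // _; rewrite gmulfM.
Qed.

Lemma pullback_coboundary m (w : cochain H R m) :
  coboundary w -> coboundary (pullback_cochain w).
Proof.
case: m w => [|m] w /=; first by move=> ->.
by move=> [b ->]; exists (pullback_cochain b); rewrite diff_pullback.
Qed.

Fact pullback_cocycle_subproof m (w : cocycle H R m) :
  cobd (pullback_cochain w) == 0.
Proof. by rewrite diff_pullback (eqP (cocycleP w)). Qed.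

Definition pullback_cocycle m (w : cocycle H R m) : cocycle G R m :=
  Cocycle (pullback_cocycle_subproof w).

(* Independence of the representative is pullbackE. *)
Definition pullback m (x : cohomology H R m) : cohomology G R m :=
  cohom_class (pullback_cocycle (repr x)).

Lemma pullbackE m (w : cocycle H R m) :
  pullback (cohom_class w) = cohom_class (pullback_cocycle w).
Proof.
suff key v : cohom_class v = cohom_class w ->
    cohom_class (pullback_cocycle v) = cohom_class (pullback_cocycle w).
  exact/key/reprK.
move=> /cohom_class_eqP/pullback_coboundary hv; exact/cohom_class_eqP.
Qed.
End Pullback.

(* The bound M may depend on all entries of g but the first one, which is the
   only entry where h may differ from g. This is meant for m > 0. *)
Definition one_bounded (G : groupType) (R : realType) (m : nat)
    (w : cochain G R m) : Prop :=
  forall g : 'I_m -> G, exists M : R, forall h : 'I_m -> G,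
    (forall j : 'I_m, (0 < j)%N -> h j = g j) -> `|w h| <= M.

Definition commutator_subgroup (G : groupType) : {pred G} := fun x =>
  `[< forall S : {pred G}, group_closed S ->
        (forall a b : G, [~ a, b]%g \in S) -> x \in S >].

Fact commutator_subgroup_closed (G : groupType) :
  group_closed (@commutator_subgroup G).
Proof.
split=> [|x y /asboolP hx /asboolP hy]; apply/asboolP => S Sgrp Scomm.
  by case: Sgrp.
by apply: Sgrp.2; [exact: hx | exact: hy].
Qed.

Record derived (G : groupType) := Derived {
  derived_val :> G;
  derivedP : commutator_subgroup derived_val
}.

HB.instance Definition _ G := [isSub for @derived_val G].
HB.instance Definition _ G := [Choice of derived G by <:].
HB.instance Definition _ G := SubChoice_isSubGroup.Build
  G (@commutator_subgroup G) (derived G) (@commutator_subgroup_closed G).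

Section ThompsonF.
Variable R : realType.
Implicit Types (f g : R -> R) (x y : R).

Definition dyadic x := exists (k : int) (m : nat), x = k%:~R / 2 ^+ m.

(* s contains the breakpoints of f: on every interval whose interior misses s,
   f is affine with slope a power of 2. *)
Definition pl_map (s : seq R) f : Prop :=
  forall a b, a < b -> (forall c, c \in s -> c \notin `]a, b[) ->
    exists (k : int) (d : R), forall x, x \in `[a, b] -> f x = 2 ^ k * x + d.

(* An orientation-preserving homeomorphism of [0, 1] is represented by its
   extension to the real line by the identity. *)
Definition thompson_map f : Prop :=
  [/\ exists g, [/\ cancel f g, cancel g f, continuous f & continuous g],
      {homo f : x y / x < y},
      forall x, x \notin `[0, 1] -> f x = x
    & exists2 s : seq R, (forall c, c \in s -> dyadic c) & pl_map s f].

Lemma thompson_mono f : {homo f : x y / x < y} -> {mono f : x y / x < y}.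
Proof. by move=> h; exact/leW_mono/le_mono. Qed.

Lemma thompson_step (s : seq R) x : (exists2 c, c \in s & c < x) ->
  exists c, [/\ c \in s, c < x & forall c', c' \in s -> c' \notin `]c, x[].
Proof.
elim: s => [[]//|a s IH] [c]; rewrite inE => cs cx.
have [/IH[d [ds dx dP]]|no] := pselect (exists2 c, c \in s & c < x).
  have [ad|da] := leP a d.
    exists d; split=> // [|c']; first by rewrite inE ds orbT.
    rewrite inE => /orP[/eqP->|/dP//]; rewrite in_itv/= negb_and -leNgt ad//.
  have [ax|xa] := ltP a x.
    exists a; split=> // [|c']; first by rewrite inE eqxx.
    rewrite inE => /orP[/eqP->|/dP]; first by rewrite in_itv/= ltxx.
    rewrite !in_itv/= !negb_and -!leNgt => /orP[c'd|->]; last by rewrite orbT.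
    by rewrite (le_trans c'd (ltW da)).
  exists d; split=> // [|c']; first by rewrite inE ds orbT.
  rewrite inE => /orP[/eqP->|/dP//]; rewrite in_itv/= negb_and -!leNgt.
  by rewrite xa orbT.
move: cs => /orP[/eqP ca|cs]; last by exfalso; apply: no; exists c.
subst a; exists c; split=> // [|c']; first by rewrite inE eqxx.
rewrite inE => /orP[/eqP->|c's]; first by rewrite in_itv/= ltxx.
rewrite in_itv/= negb_and -!leNgt orbC; case: leP => // c'x.
by exfalso; apply: no; exists c'.
Qed.

Lemma dyadicD x y : dyadic x -> dyadic y -> dyadic (x + y).
Proof.
move=> [k [m ->]] [l [n ->]]; exists (k * 2 ^+ n + l * 2 ^+ m), (m + n)%N.
rewrite intrD !intrM !rmorphXn /= exprD; field.
by rewrite !expf_neq0.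
Qed.

Lemma dyadicN x : dyadic x -> dyadic (- x).
Proof. by move=> [k [m ->]]; exists (- k), m; rewrite intrN mulNr. Qed.

Lemma dyadicZ (k : int) x : dyadic x -> dyadic (2 ^ k * x).
Proof.
move=> [l [n ->]]; case: k => m.
  exists (2 ^+ m * l), n; rewrite intrM rmorphXn /= -exprnP; ring.
exists l, (m.+1 + n)%N; rewrite NegzE -exprnN exprD; field.
by rewrite !expf_neq0.
Qed.


Lemma pl_map_dyadic (s : seq R) f x :
  (forall c, c \in s -> dyadic c) -> pl_map s f ->
  (forall x, x \notin `[0, 1] -> f x = x) -> dyadic x <-> dyadic (f x).
Proof.
move=> sdy fpl fid.
have count_lt (t : seq R) (c y : R) : c \in t -> c < y ->
    (count (< c) t < count (< y) t)%N.
  move=> + cy; elim: t => [//|e t IH] /=; rewrite inE => /orP[/eqP <-|/IH lt].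
    rewrite ltxx cy add0n add1n ltnS; apply: sub_count => z /=.
    by move=> /lt_trans; apply.
  rewrite -addnS leq_add//; case: (ltP e c) => // ec.
  by rewrite (lt_trans ec cy).
have [n] := ubnP (count (< x) s); elim: n x => // n IH x; rewrite ltnS => xn.
have [x01|/fid->//] := boolP (x \in `[0, 1]).
have [c [cx cdy sc]] : exists c, [/\ c < x, dyadic c /\ dyadic (f c) &
    forall c', c' \in s -> c' \notin `]c, x[].
  have [|no] := pselect (exists2 c, c \in s & c < x).
    move=> /thompson_step[c [cs cx sc]]; exists c; split=> //.
    split; first exact: sdy.
    have [h _] := IH c (leq_trans (count_lt _ _ _ cs cx) xn).
    exact/h/sdy.
  have m1 : dyadic (-1) by exists (-1), 0%N; rewrite expr0 divr1.
  exists (-1); split.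
  - by move: x01; rewrite in_itv/= => /andP[x0 _]; apply: lt_le_trans x0; lra.
  - by rewrite fid// in_itv/= negb_and -ltNge; apply/orP; left; lra.
  - move=> c' cs; rewrite in_itv/= negb_and -!leNgt; apply/orP; right.
    by rewrite leNgt; apply/negP => c'x; apply: no; exists c'.
have [k [d kd]] := fpl _ _ cx sc.
have fx := kd x; have fc := kd c.
rewrite !in_itv/= !lexx (ltW cx)/= in fx fc.
have {fx fc}e : f x - f c = 2 ^ k * (x - c) by rewrite fx// fc//; ring.
have e' : x - c = 2 ^ (- k) * (f x - f c).
  by rewrite e mulrA -expfzDr// addNr expr0z mul1r.
case: cdy => cdy fcdy; split=> [xdy|fxdy].
  rewrite -(subrK (f c) (f x)) e; apply: dyadicD => //; apply: dyadicZ.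
  exact/dyadicD/dyadicN.
rewrite -(subrK c x) e'; apply: dyadicD => //; apply: dyadicZ.
exact/dyadicD/dyadicN.
Qed.

Lemma thompson_map_id : thompson_map idfun.
Proof.
split=> //; first by exists idfun; split=> // x; exact: cvg_id.
exists [::] => // a b _ _; exists 0, 0 => x _.
by rewrite expr0z mul1r addr0.
Qed.

Lemma thompson_map_comp f g :
  thompson_map f -> thompson_map g -> thompson_map (f \o g).
Proof.
move=> [[f' [fK f'K fc f'c]] fh fid [sf sfdy fpl]].
move=> [[g' [gK g'K gc g'c]] gh gid [sg sgdy gpl]].
split.
- exists (g' \o f'); split; [exact: can_comp|exact: can_comp| |].
    by move=> x; apply: continuous_comp; [exact: gc|exact: fc].
  by move=> x; apply: continuous_comp; [exact: f'c|exact: g'c].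
- by move=> x y /gh /fh.
- by move=> x x01 /=; rewrite gid// fid.
- exists (sg ++ map g' sf).
    move=> c; rewrite mem_cat => /orP[/sgdy//|/mapP[e /sfdy edy ->]].
    by apply/(pl_map_dyadic _ sgdy gpl gid); rewrite g'K.
  move=> a b ab sP.
  have [|k [d kd]] := gpl a b ab.
    by move=> c cs; apply: sP; rewrite mem_cat cs.
  have gm := thompson_mono gh.
  have [|l [e le]] := fpl _ _ (gh _ _ ab).
    move=> c cs; have := sP (g' c).
    rewrite mem_cat map_f ?orbT// !in_itv/= => /(_ isT).
    by rewrite -(gm a) -(gm _ b) g'K.
  exists (l + k), (2 ^ l * d + e) => x xab /=.
  rewrite le; last first.
    by move: xab; rewrite !in_itv/= !(le_mono gh).
  by rewrite kd// expfzDr//; ring.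
Qed.

Lemma thompson_map_inv f g :
  cancel f g -> cancel g f -> continuous f -> continuous g -> 
  thompson_map f -> thompson_map g.
Proof.
move=> fK gK fc gc [_ fh fid [s sdy fpl]].
have fm := thompson_mono fh.
have gh : {homo g : x y / x < y} by move=> x y; rewrite -(fm (g x)) !gK.
split=> //; first by exists f.
  by move=> x /fid fx; rewrite -{1}fx fK.
exists (map f s).
  move=> c /mapP[e /sdy edy ->].
  by have [h _] := pl_map_dyadic e sdy fpl fid; exact: h.
move=> a b ab sP.
have [|k [d kd]] := fpl _ _ (gh _ _ ab).
  move=> c cs; have := sP (f c); rewrite map_f// !in_itv/= => /(_ isT).
  by rewrite -(fm _ c) -(fm c) !gK.
exists (- k), (- 2 ^ (- k) * d) => x xab.
have /kd gxE : g x \in `[g a, g b].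
  by move: xab; rewrite !in_itv/= !(le_mono gh).
rewrite gK in gxE.
rewrite [in RHS]gxE mulrDr mulrA -expfzDr// addNr expr0z mul1r mulNr.
by rewrite addrK.
Qed.

Record thompson := Thompson {
  thompson_fun :> R -> R;
  thompsonP : `[< thompson_map thompson_fun >]
}.

HB.instance Definition _ := [isSub for thompson_fun].
HB.instance Definition _ := [Choice of thompson by <:].

Definition thompson_one := Thompson (asboolT thompson_map_id).

Definition thompson_mul (f g : thompson) := Thompson
  (asboolT (thompson_map_comp (asboolW (thompsonP f)) (asboolW (thompsonP g)))).

Fact thompson_inv_subproof (f : thompson) :
  exists g : thompson, cancel f g /\ cancel g f.
Proof.
have /asboolP fP := thompsonP f; case: (fP) => -[g [fK gK fc gc]] _ _ _.
by exists (Thompson (asboolT (thompson_map_inv fK gK fc gc fP))).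
Qed.

Definition thompson_inv (f : thompson) : thompson :=
  projT1 (cid (thompson_inv_subproof f)).

Fact thompson_mulA : associative thompson_mul.
Proof. by move=> f g h; apply: val_inj. Qed.

Fact thompson_mul1 : left_id thompson_one thompson_mul.
Proof. by move=> f; apply: val_inj. Qed.

Fact thompson_mul1r : right_id thompson_one thompson_mul.
Proof. by move=> f; apply: val_inj. Qed.

Fact thompson_mulV : left_inverse thompson_one thompson_inv thompson_mul.
Proof.
move=> f; apply: val_inj; rewrite /= /thompson_inv; case: cid => g [fK gK] /=.
exact/funext.
Qed.

Fact thompson_mulVr : right_inverse thompson_one thompson_inv thompson_mul.
Proof.
move=> f; apply: val_inj; rewrite /= /thompson_inv; case: cid => g [fK gK] /=.
exact/funext.
Qed.

HB.instance Definition _ := isGroup.Build thompson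
  thompson_mulA thompson_mul1 thompson_mul1r thompson_mulV thompson_mulVr.

Definition lderiv f x := (lim ((f (x + h) - f x) / h @[h --> 0^'-]))%classic.
Definition rderiv f x := (lim ((f (x + h) - f x) / h @[h --> 0^'+]))%classic.

Definition log2 x := ln x / ln 2.


(* Rows: left and right derivatives at x; columns: g and f \o g. *)
Definition germ_matrix f g x : 'M[R]_2 := \matrix_(i, j)
  log2 ((if i == 0 then lderiv else rderiv) (if j == 0 then g else f \o g) x).

(* The determinant vanishes unless x is a breakpoint of g or of f \o g, so the
   sum has finite support. Elements of [F, F] are the identity near 0 and 1,
   so the endpoints do not contribute. *)
Definition gs_sum f g : R :=
  \sum_(x \in `]0, 1[%classic) \det (germ_matrix f g x).

Lemma log2_exprz (k : int) : log2 (2 ^ k) = k%:~R.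
Proof.
have l2 : ln 2 != 0 :> R by rewrite gt_eqF// ln_gt0// ltr1n.
rewrite /log2; case: k => n.
  by rewrite -exprnP lnXn// -[_ *+ n]mulr_natl mulfK.
rewrite NegzE -exprnN lnV ?posrE ?exprn_gt0// lnXn//.
by rewrite -[_ *+ _.+1]mulr_natl mulNr mulfK.
Qed.

Lemma rderiv_eq f x b (s : R) : x < b ->
  (forall y, x <= y <= b -> f y = f x + s * (y - x)) -> rderiv f x = s.
Proof.
move=> xb fE; apply: cvg_lim => //; apply: cvg_near_cst; near=> h.
have h0 : 0 < h by near: h; exact: nbhs_right_gt.
have hb : h < b - x by near: h; apply: nbhs_right_lt; rewrite subr_gt0.
rewrite fE; first by field; rewrite gt_eqF.
by rewrite lerDl (ltW h0)/= addrC -lerBrDr ltW.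
Unshelve. all: by end_near. Qed.

Lemma lderiv_eq f x a (s : R) : a < x ->
  (forall y, a <= y <= x -> f y = f x + s * (y - x)) -> lderiv f x = s.
Proof.
move=> ax fE; apply: cvg_lim => //; apply: cvg_near_cst; near=> h.
have h0 : h < 0 by near: h; exact: nbhs_left_lt.
have ha : a - x < h by near: h; apply: nbhs_left_gt; rewrite subr_lt0.
rewrite fE; first by field; rewrite lt_eqF.
by rewrite gerDl (ltW h0) andbT addrC -lerBlDr ltW.
Unshelve. all: by end_near. Qed.

Lemma gap_right (s : seq R) x :
  exists2 b, x < b & forall c, c \in s -> c \notin `]x, b[.
Proof.
elim: s => [|a s [b xb sb]]; first by exists (x + 1) => //; rewrite ltrDl.
have [xa|ax] := ltP x a.
  exists (Num.min a b); first by rewrite lt_min xa.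
  move=> c; rewrite inE => /orP[/eqP->|/sb].
    by rewrite in_itv/= lt_min ltxx andbF.
  by rewrite !in_itv/= lt_min !negb_and => /orP[->//|->]; rewrite !orbT.
exists b => // c; rewrite inE => /orP[/eqP->|/sb//].
by rewrite in_itv/= ltNge ax.
Qed.

Lemma gap_left (s : seq R) x :
  exists2 a, a < x & forall c, c \in s -> c \notin `]a, x[.
Proof.
elim: s => [|b s [a ax sa]].
  by exists (x - 1) => //; rewrite ltrBlDr ltrDl.
have [bx|xb] := ltP b x.
  exists (Num.max a b); first by rewrite gt_max ax.
  move=> c; rewrite inE => /orP[/eqP->|/sa].
    by rewrite in_itv/= gt_max ltxx andbF.
  by rewrite !in_itv/= gt_max !negb_and => /orP[->//|->]; rewrite !orbT.
exists a => // c; rewrite inE => /orP[/eqP->|/sa//].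
by rewrite in_itv/= !negb_and -!leNgt xb orbT.
Qed.

Lemma pl_gap s f a b : pl_map s f -> a < b ->
  (forall c, c \in s -> c \notin `]a, b[) ->
  exists k : int, forall x y, a <= x <= b -> a <= y <= b ->
    f y = f x + 2 ^ k * (y - x).
Proof.
move=> fpl ab sab; have [k [d kd]] := fpl a b ab sab.
exists k => x y xab yab; rewrite !kd ?in_itv//=; ring.
Qed.

Lemma rgerm s f x : pl_map s f -> exists (k : int) (b : R), x < b /\
  forall y, x <= y <= b -> f y = f x + 2 ^ k * (y - x).
Proof.
move=> fpl; have [b xb sb] := gap_right s x.
have [k kE] := pl_gap fpl xb sb.
by exists k, b; split=> // y yxb; apply: kE; rewrite ?lexx ?(ltW xb).
Qed.

Lemma lgerm s f x : pl_map s f -> exists (k : int) (a : R), a < x /\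
  forall y, a <= y <= x -> f y = f x + 2 ^ k * (y - x).
Proof.
move=> fpl; have [a ax sa] := gap_left s x.
have [k kE] := pl_gap fpl ax sa.
by exists k, a; split=> // y yxb; apply: kE; rewrite ?lexx ?(ltW ax).
Qed.

Lemma rderiv_comp f g x : thompson_map f -> thompson_map g ->
  log2 (rderiv (f \o g) x) = log2 (rderiv f (g x)) + log2 (rderiv g x).
Proof.
move=> [_ _ _ [sf _ fpl]] [[g' [gK g'K _ _]] gh _ [sg _ gpl]].
have [k [b [xb kE]]] := rgerm x gpl.
have [l [d [gxd lE]]] := rgerm (g x) fpl.
rewrite (rderiv_eq xb kE) (rderiv_eq gxd lE).
rewrite (@rderiv_eq _ _ (Num.min b (g' d)) (2 ^ l * 2 ^ k)).
- by rewrite -expfzDr// !log2_exprz intrD.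
- by rewrite lt_min xb -(thompson_mono gh) g'K.
move=> y; rewrite le_min => /and3P[xy yb]; rewrite -(le_mono gh) g'K => yd /=.
rewrite lE ?yd ?(le_mono gh) ?xy// (kE y) ?xy//; ring.
Qed.

Lemma lderiv_comp f g x : thompson_map f -> thompson_map g ->
  log2 (lderiv (f \o g) x) = log2 (lderiv f (g x)) + log2 (lderiv g x).
Proof.
move=> [_ _ _ [sf _ fpl]] [[g' [gK g'K _ _]] gh _ [sg _ gpl]].
have [k [b [xb kE]]] := lgerm x gpl.
have [l [d [gxd lE]]] := lgerm (g x) fpl.
rewrite (lderiv_eq xb kE) (lderiv_eq gxd lE).
rewrite (@lderiv_eq _ _ (Num.max b (g' d)) (2 ^ l * 2 ^ k)).
- by rewrite -expfzDr// !log2_exprz intrD.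
- by rewrite gt_max xb -(thompson_mono gh) g'K.
move=> y; rewrite ge_max => /andP[/andP[yb]].
rewrite -(le_mono gh) g'K => yd xy /=.
rewrite lE ?yd ?(le_mono gh) ?xy// (kE y) ?yb//; ring.
Qed.

Lemma lderiv_rderiv s f x : pl_map s f -> x \notin s -> lderiv f x = rderiv f x.
Proof.
move=> fpl xs; have [a ax sa] := gap_left s x; have [b xb sb] := gap_right s x.
have [|k kE] := pl_gap fpl (lt_trans ax xb).
  move=> c cs; have cx : c != x by apply: contraNneq xs => <-.
  move: (sa c cs) (sb c cs); rewrite !in_itv/= !negb_and -!leNgt.
  move: cx; rewrite neq_lt => /orP[cx|xc].
    by rewrite (leNgt x) cx orbF => ->.
  by rewrite (leNgt c x) xc /= => _ ->; rewrite orbT.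
have [al lb] := (ltW ax, ltW xb).
rewrite (lderiv_eq ax (s := 2 ^ k)); last first.
  by move=> y /andP[ay yx]; apply: kE; rewrite ?al// ay (le_trans yx).
rewrite (rderiv_eq xb (s := 2 ^ k))//.
by move=> y /andP[xy yb]; apply: kE; rewrite ?al// yb (le_trans al).
Qed.

Lemma det_germ_matrix f g x : \det (germ_matrix f g x) =
  log2 (lderiv g x) * log2 (rderiv (f \o g) x) -
  log2 (lderiv (f \o g) x) * log2 (rderiv g x).
Proof.
rewrite (expand_det_row _ 0) !big_ord_recl big_ord0 /cofactor !det_mx11 !mxE /=.
by rewrite expr0 expr1; ring.
Qed.

Lemma thompson_map_itv f x : thompson_map f -> 0 < x < 1 -> 0 < f x < 1.
Proof.
move=> [[f' [fK _ _ _]] fh fid _] /andP[x0 x1].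
apply/andP; split; rewrite ltNge; apply/negP => fx.
  have fz : f (x / 2) < 0 by apply: lt_le_trans fx; apply: fh; lra.
  have : f (f (x / 2)) = f (x / 2).
    by apply: fid; rewrite in_itv/= negb_and -ltNge fz.
  move=> /(can_inj fK) e; lra.
have fz : 1 < f ((x + 1) / 2) by apply: le_lt_trans fx _; apply: fh; lra.
have : f (f ((x + 1) / 2)) = f ((x + 1) / 2).
  by apply: fid; rewrite in_itv/= negb_and -!ltNge fz orbT.
move=> /(can_inj fK) e; lra.
Qed.

Lemma gs_sum_cocycle f g h :
  thompson_map f -> thompson_map g -> thompson_map h ->
  gs_sum g h - gs_sum (f \o g) h + gs_sum f (g \o h) - gs_sum f g = 0.
Proof.
move=> fP gP hP.
have ghP := thompson_map_comp gP hP; have fgP := thompson_map_comp fP gP.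
have fghP := thompson_map_comp fP ghP.
have hbij : set_bij `]0, 1[%classic `]0, 1[%classic h.
  have [[h' [hK h'K hc h'c]] hh _ _] := hP.
  have h'P := thompson_map_inv hK h'K hc h'c hP.
  split=> [x|x y _ _ /(can_inj hK)//|y] /=; rewrite in_itv.
    exact: thompson_map_itv.
  by move=> /(thompson_map_itv h'P) h'y; exists (h' y); rewrite ?in_itv.
have lg x : log2 (lderiv g (h x)) =
    log2 (lderiv (g \o h) x) - log2 (lderiv h x).
  by rewrite lderiv_comp// addrK.
have rg x : log2 (rderiv g (h x)) =
    log2 (rderiv (g \o h) x) - log2 (rderiv h x).
  by rewrite rderiv_comp// addrK.
have lfg x : log2 (lderiv (f \o g) (h x)) =
    log2 (lderiv (f \o (g \o h)) x) - log2 (lderiv h x).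
  by rewrite compA (lderiv_comp x fgP hP) addrK.
have rfg x : log2 (rderiv (f \o g) (h x)) =
    log2 (rderiv (f \o (g \o h)) x) - log2 (rderiv h x).
  by rewrite compA (rderiv_comp x fgP hP) addrK.
rewrite {4}/gs_sum (reindex_fsbig h `]0, 1[%classic)//=.
have [_ _ _ [s1 _ p1]] := hP; have [_ _ _ [s2 _ p2]] := ghP.
have [_ _ _ [s3 _ p3]] := fghP.
pose r := undup [seq x <- s1 ++ s2 ++ s3 | x \in `]0, 1[%classic].
have rP x : x \in `]0, 1[%classic -> x \notin r ->
   [/\ lderiv h x = rderiv h x, lderiv (g \o h) x = rderiv (g \o h) x &
    lderiv (f \o (g \o h)) x = rderiv (f \o (g \o h)) x].
  move=> x01; rewrite mem_undup mem_filter x01 !mem_cat !negb_or.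
  by move=> /and3P[? ? ?]; split; apply: lderiv_rderiv; eassumption.
have ru : uniq r by exact: undup_uniq.
have rsub : ([set` r] `<=` `]0, 1[)%classic.
  by move=> x /=; rewrite mem_undup mem_filter => /andP[/set_mem].
have rE (F : R -> R) : (forall x, lderiv h x = rderiv h x ->
     lderiv (g \o h) x = rderiv (g \o h) x ->
     lderiv (f \o (g \o h)) x = rderiv (f \o (g \o h)) x -> F x = 0) ->
   \sum_(x \in `]0, 1[%classic) F x = \sum_(x <- r | x \in `]0, 1[%classic) F x.
  move=> F0; apply: fsbigE => // x x01 xr.
  by have [? ? ?] := rP x (mem_set x01) xr; exact: F0.
rewrite /gs_sum !rE; last 4 first.
- move=> x e1 e2 e3; rewrite det_germ_matrix.
  by rewrite lg rg lfg rfg e1 e2 e3; ring.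
- by move=> x e1 e2 e3; rewrite det_germ_matrix e2 e3; ring.
- by move=> x e1 e2 e3; rewrite det_germ_matrix -compA e1 e3; ring.
- by move=> x e1 e2 e3; rewrite det_germ_matrix e1 e2; ring.
rewrite -sumrB -big_split /= -sumrB big1// => x _.
rewrite !det_germ_matrix /=.
rewrite lg rg lfg rfg -(compA f g h); ring.
Qed.

End ThompsonF.

Section GhysSergiescu.
Variable R : realType.

Definition gs_cochain : cochain (derived (thompson R)) R 2 := fun g =>
  gs_sum (thompson_fun (derived_val (g 0))) (thompson_fun (derived_val (g 1))).

Fact gs_cocycle_subproof : cobd gs_cochain == 0.
Proof.
apply/eqP/funext => g.
have tP (x : derived (thompson R)) :
    thompson_map (thompson_fun (derived_val x)).
  exact: asboolW (thompsonP _).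
have ordE (i j : 'I_3) : i = j :> nat -> g i = g j.
  by move=> ij; congr g; exact: val_inj.
pose F i : R -> R := thompson_fun (derived_val (g i)).
pose i1 : 'I_3 := lift ord0 0; pose i2 : 'I_3 := lift ord0 1.
have l0 : g (lift ord_max 0) = g ord0 by exact: ordE.
have l1 : g (lift ord_max 1) = g i1 by exact: ordE.
have e1 : gs_cochain (merge_at ord0 g) = gs_sum (F ord0 \o F i1) (F i2).
  by rewrite /gs_cochain /merge_at /= l0.
have e2 : gs_cochain (merge_at (lift ord0 ord0) g) =
    gs_sum (F ord0) (F i1 \o F i2).
  by rewrite /gs_cochain /merge_at /= l0 l1.
have e3 : gs_cochain (g \o lift ord_max) = gs_sum (F ord0) (F i1).
  by rewrite /gs_cochain /= l0 l1.
rewrite /cobd !big_ord_recl big_ord0 e1 e2 e3.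
rewrite -[RHS](gs_sum_cocycle (tP (g ord0)) (tP (g i1)) (tP (g i2))).
rewrite -[gs_cochain _]/(gs_sum (F i1) (F i2)) /=; ring.
Qed.

Definition gs_cocycle : cocycle (derived (thompson R)) R 2 :=
  Cocycle gs_cocycle_subproof.

Definition gs_class : cohomology (derived (thompson R)) R 2 :=
  cohom_class gs_cocycle.

End GhysSergiescu.

(* Main.v *)
Require Import Defs.
From HB Require Import structures.
From mathcomp Require Import all_boot all_order all_algebra.
From mathcomp Require Import all_fingroup zify ring lra.
From mathcomp Require Import all_classical all_reals all_analysis.

(** A class of degree m on Z^m is detected by pairing it with the fundamental
    class of the m-torus, which is the signed sum of the tuples
    (e_(s 0), ..., e_(s (m-1))) over all permutations s of the standard basis.
    This is [alternation]; it kills coboundaries ([alternation_cobd]). It also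
    kills cocycles that are bounded in their first entry
    ([one_bounded_alternation]): since Z^m is amenable, averaging a 1-bounded
    cocycle over its first entry exhibits it as a limit of coboundaries. Hence
    one homomorphism psi with nonzero alternation of psi^* alpha^n proves both
    claims, for a 1-bounded representative of u^n would pull back to a
    1-bounded cocycle with the same alternation.

    The homomorphism uses 2n elements with consecutive supports. Take a chain of
    2n intervals, each beginning where the preceding one ends, and on each of
    them an element of F with nontrivial slopes at both ends. These elements
    commute. The determinant in alpha (f, g), for f and g with disjoint
    supports, is the antisymmetric expression
    log g'_L log f'_R - log f'_L log g'_R at x ([gs_sum_disjoint]), which is
    nonzero only where the support of one map ends and that of the other
    begins. So alpha pairs neighbours of the chain nontrivially and all other
    pairs of distinct elements trivially. To land in the commutator subgroup,
    each element beta is replaced by the commutator of beta with an element t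
    moving the whole chain off itself. This adds an inverted copy of the chain
    elsewhere, and inverting both maps does not change the product of two
    logarithmic slopes, so the contributions of the chain and of its copy
    add up ([gs_sum_chain]).

    The cochain alpha^n evaluates alpha on consecutive pairs of entries
    ([cup_pow_class]), so the alternation of psi^* alpha^n is a multiple of the
    Pfaffian of the tridiagonal antisymmetric matrix just described. It is
    nonzero, because a path with 2n vertices has exactly one perfect matching
    ([pfaffian_neq0]). Finally, psi is injective because the left slope at the
    end of the k-th interval determines the k-th coordinate. *)

Import Order.TTheory GRing.Theory Num.Theory.
Import numFieldNormedType.Exports.

Local Open Scope ring_scope.

(** * Pairing with the fundamental class of a torus *)

(** For a commuting family e this is the pairing of w with the image of the
    fundamental class of the torus Z^m under the homomorphism sending the
    standard basis to e: that class is represented by the signed sum of the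
    tuples (e_(s 0), ..., e_(s (m-1))), one for each simplex of the standard
    triangulation of the cube. *)
Definition alternation {G : groupType} {R : comNzRingType} {m : nat}
    (w : cochain G R m) (e : 'I_m -> G) : R :=
  \sum_(s : 'S_m) (-1) ^+ s * w (e \o s).

Lemma alternationB (G : groupType) (R : comNzRingType) m
    (w v : cochain G R m) e :
  alternation (w - v) e = alternation w e - alternation v e.
Proof.
rewrite /alternation -sumrB; apply: eq_bigr => s _; rewrite -mulrBr.
by congr (_ * _).
Qed.

Lemma alternation_pullback (G H : groupType) (R : comNzRingType)
    (psi : {multiplicative G -> H}) m (w : cochain H R m) e :
  alternation (pullback_cochain psi w) e = alternation w (psi \o e).
Proof. by []. Qed.

Lemma merge_at_swap (G : groupType) m (i : 'I_m) (e : 'I_m.+1 -> G)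
    (s : 'S_m.+1) :
  (forall a b, commute (e a) (e b)) ->
  merge_at i (e \o (tperm (lift ord_max i) (lift ord0 i) * s)%g) =
  merge_at i (e \o s).
Proof.
move=> comm_e; apply/funext => j; rewrite /merge_at.
have jm := ltn_ord j; have im := ltn_ord i.
case: ltngtP => ji; last 1 first.
- by rewrite -(ord_inj ji) eqxx /= !permM tpermL tpermR; exact: comm_e.
- by rewrite /= permM tpermD //; apply/eqP => /(congr1 val);
    rewrite /= /bump ?[(m <= _)%N]leqNgt ?ltn_ord /=; lia.
- case: eqP => [jE|_]; first by move: ji; rewrite jE ltnn.
  by rewrite /= permM tpermD //; apply/eqP => /(congr1 val);
    rewrite /= /bump ?[(m <= _)%N]leqNgt ?ltn_ord /=; lia.
Qed.

(** The tuples of [alternation] form a cycle. An inner face merges two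
    commuting neighbours, so exchanging them preserves the face and reverses
    the sign. The two outer faces drop the first or the last entry and are
    exchanged by a cyclic rotation of all m + 1 entries, whose sign (-1)^m is
    opposite to the sign (-1)^(m + 1) of the last face in the coboundary. *)
Lemma alternation_cobd (G : groupType) (R : realDomainType) m
    (b : cochain G R m) (e : 'I_m.+1 -> G) :
  (forall i j, commute (e i) (e j)) -> alternation (cobd b) e = 0.
Proof.
move=> comm_e; rewrite /alternation /cobd.
under eq_bigr do rewrite !mulrDr mulr_sumr.
rewrite !big_split /= exchange_big /= [X in _ + X + _]big1 => [|i _].
  (* the rotation matching the first face of a tuple with the last *)
  pose c : 'S_m.+1 := lift_perm ord_max ord0 1%g.
  rewrite addr0 [X in X + _](_ : _ = \sum_(s : 'S_m.+1)
    (-1) ^+ m * ((-1) ^+ s * b (e \o s \o lift ord_max))); last first.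
    rewrite [RHS](reindex_inj (mulgI c)); apply: eq_bigr => s _.
    rewrite odd_permM odd_lift_perm odd_perm1 /= !addbF signr_addb signr_odd.
    rewrite !mulrA -exprD addnn -mul2n exprM sqrrN !expr1n mul1r.
    congr (_ * b _); apply/funext => j /=.
    by rewrite permM lift_perm_lift perm1.
  rewrite -big_split /= big1 // => s _; rewrite exprS /=.
  by rewrite mulN1r mulNr mulrN mulrCA subrr.
(* the sum S over one inner face satisfies S = - S *)
set S := \sum_(s : _) _; apply/eqP; rewrite -[S == 0]eqNr; apply/eqP.
rewrite {1}/S (reindex_inj (mulgI (tperm (lift ord_max i) (lift ord0 i)))).
rewrite -sumrN.
apply: eq_bigr => s _ /=; rewrite merge_at_swap // odd_permM odd_tperm.
have -> : lift ord_max i != lift ord0 i.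
  by apply/eqP => /(congr1 val); rewrite /= /bump leqNgt ltn_ord /=; lia.
by rewrite signr_addb expr1 mulN1r mulNr opprK.
Qed.

(** Amenability of Z^m in elementary form. Averaging the identity
    c = sum_i (F_i (h e_i) - F_i h) over h, h e_0, ..., h e_0^(N-1) makes the
    term of e_0 telescope to a quantity of size at most 2 M / N, while the
    other averaged functions are still bounded by M, because e_0 commutes with
    the e_i. So one direction can be removed at the cost of an arbitrarily
    small error; the error eps in the statement is what lets the induction on
    the number of directions go through. *)
Lemma bounded_drift (G : groupType) (R : realType) m (e : 'I_m -> G)
    (F : 'I_m -> G -> R) (M c eps : R) :
  (forall i j, commute (e i) (e j)) -> (forall i h, `|F i h| <= M) ->
  (forall h, `|c - \sum_i (F i (h * e i)%g - F i h)| <= eps) ->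
  `|c| <= eps.
Proof.
elim: m e F eps => [|m IH] e F eps comm_e FM cF.
  by have := cF 1%g; rewrite big_ord0 subr0.
apply/ler_addgt0Pr => d d0.
pose N := (Num.truncn (d^-1 * (2 * M))).+1.
have N0 : 0 < N%:R :> R by rewrite ltr0n.
have Nd : 2 * M / N%:R <= d.
  rewrite ler_pdivrMr // -ler_pdivrMl // /N.
  by apply: ltW; exact: truncnS_gt.
pose avg (f : G -> R) h := (\sum_(k < N) f (h * e ord0 ^+ k)%g) / N%:R.
have avg_le f B h : (forall h, `|f h| <= B) -> `|avg f h| <= B.
  move=> fB; rewrite /avg normrM normfV (gtr0_norm N0) ler_pdivrMr //.
  apply: le_trans (ler_norm_sum _ _ _) _.
  apply: le_trans (ler_sum _ (fun k _ => fB _)) _.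
  by rewrite sumr_const card_ord mulr_natr.
apply: (IH (e \o lift ord0) (fun i => avg (F (lift ord0 i)))).
- by move=> i j; exact: comm_e.
- by move=> i h; apply: avg_le => ?; exact: FM.
move=> h.
pose D h := c - \sum_i (F i (h * e i)%g - F i h).
have DE : avg D h =
    c - (\sum_(i < m) (avg (F (lift ord0 i)) (h * e (lift ord0 i))%g
                       - avg (F (lift ord0 i)) h))
      - (F ord0 (h * e ord0 ^+ N)%g - F ord0 h) / N%:R.
  rewrite /avg -[c in RHS](mulfK (lt0r_neq0 N0)) mulr_natr.
  under [in RHS]eq_bigr do rewrite -mulrBl -sumrB.
  rewrite -mulr_suml -!mulrBl; congr (_ / _).
  have -> : c *+ N = \sum_(k < N) c by rewrite sumr_const card_ord.
  rewrite exchange_big /= -sumrB.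
  have -> : F ord0 (h * e ord0 ^+ N)%g - F ord0 h =
      \sum_(k < N) (F ord0 (h * e ord0 ^+ k * e ord0)%g
                    - F ord0 (h * e ord0 ^+ k)%g).
    rewrite -{2}[h]mulg1 -(expg0 (e ord0)).
    rewrite -(telescope_sumr (fun k => F ord0 (h * e ord0 ^+ k)%g)) // big_mkord.
    by apply: eq_bigr => k _; rewrite expgSr mulgA.
  rewrite -sumrB; apply: eq_bigr => k _; rewrite /D big_ord_recl.
  under [in RHS]eq_bigr => i _.
    rewrite -mulgA (commuteX k (comm_e (lift ord0 i) ord0)) mulgA.
  over.
  rewrite /=; ring.
rewrite -[c - _](subrK ((F ord0 (h * e ord0 ^+ N)%g - F ord0 h) / N%:R)) -DE.
apply: le_trans (ler_normD _ _) _; apply: lerD; first exact: avg_le.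
apply: le_trans Nd; rewrite normrM normfV (gtr0_norm N0) ler_pM2r ?invr_gt0 //.
by apply: le_trans (ler_normB _ _) _; rewrite mulr_natl mulr2n lerD.
Qed.

(** * Cocycles bounded in the first entry *)

Definition tuple_cons {G : groupType} {m : nat} (h : G) (g : 'I_m -> G) :
    'I_m.+1 -> G :=
  fun j => oapp g h (unlift ord0 j).

Lemma tuple_cons0 (G : groupType) m (h : G) (g : 'I_m -> G) :
  tuple_cons h g ord0 = h.
Proof. by rewrite /tuple_cons unlift_none. Qed.

Lemma tuple_consS (G : groupType) m (h : G) (g : 'I_m -> G) j :
  tuple_cons h g (lift ord0 j) = g j.
Proof. by rewrite /tuple_cons liftK. Qed.

Lemma tuple_cons_eta (G : groupType) m (g : 'I_m.+1 -> G) :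
  g = tuple_cons (g ord0) (g \o lift ord0).
Proof.
by apply/funext => j; case: (unliftP ord0 j) => [k ->|->];
  rewrite ?tuple_cons0 ?tuple_consS.
Qed.

Lemma merge_at_cons0 (G : groupType) m (h : G) (g : 'I_m.+1 -> G) :
  merge_at ord0 (tuple_cons h g) = tuple_cons (h * g ord0)%g (g \o lift ord0).
Proof.
rewrite [LHS]tuple_cons_eta; congr tuple_cons.
  rewrite /merge_at ltnn eqxx tuple_consS; congr (_ * _)%g.
  by rewrite -[RHS](tuple_cons0 _ _ h g); congr tuple_cons; exact: val_inj.
by apply/funext => j; rewrite /merge_at /= tuple_consS.
Qed.

Lemma merge_at_consS (G : groupType) m (h : G) (g : 'I_m.+1 -> G) (i : 'I_m) :
  merge_at (lift ord0 i) (tuple_cons h g) = tuple_cons h (merge_at i g).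
Proof.
have e0 : lift ord_max ord0 = ord0 :> 'I_m.+2 by exact: val_inj.
have eS (j : 'I_m) :
    lift ord_max (lift ord0 j) = lift ord0 (lift ord_max j) :> 'I_m.+2.
  by apply: val_inj => /=; have := ltn_ord j; rewrite /bump; lia.
rewrite [LHS]tuple_cons_eta; congr tuple_cons.
  by rewrite /merge_at /= e0 tuple_cons0.
apply/funext => j; rewrite /merge_at /= eS !tuple_consS.
by rewrite (inj_eq lift_inj) /bump /= !add1n ltnS.
Qed.

(** Prepending h turns w into a cochain of one degree less, and its coboundary
    accounts for all faces of (h, g_0, ...) except the first two. For a cocycle
    w this writes w g as a coboundary plus the difference between the values of
    w at (h g_0, g_1, ...) and at (h, g_1, ...). *)
Lemma cobd_cons (G : groupType) (R : comNzRingType) m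
    (w : cochain G R m.+1) (h : G) (g : 'I_m.+1 -> G) :
  cobd w (tuple_cons h g) =
    w g - w (tuple_cons (h * g ord0)%g (g \o lift ord0))
    + w (tuple_cons h (g \o lift ord0))
    - cobd (fun g' => w (tuple_cons h g')) g.
Proof.
rewrite {1}/cobd big_ord_recl merge_at_cons0 expr1 mulN1r.
under eq_bigr => i _ do rewrite merge_at_consS lift0 exprS mulN1r mulNr.
rewrite sumrN.
have -> : tuple_cons h g \o lift ord0 = g.
  by apply/funext => j /=; rewrite tuple_consS.
have -> : tuple_cons h g \o lift ord_max = tuple_cons h (g \o lift ord_max).
  rewrite [LHS]tuple_cons_eta /=; congr tuple_cons.
    by rewrite -[RHS](tuple_cons0 _ _ h g); congr tuple_cons; exact: val_inj.
  apply/funext => j /=; rewrite -[RHS](tuple_consS _ _ h g).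
  congr tuple_cons; apply: val_inj.
  by have := ltn_ord j; rewrite /= /bump; lia.
rewrite /cobd exprS mulN1r mulNr.
set S := \sum_(i < m) _; set T := _ * w _.
by rewrite !opprD !addrA addrK.
Qed.

Lemma alternation_coboundary (G : groupType) (R : realDomainType) m
    (w : cochain G R m) (e : 'I_m -> G) :
  (0 < m)%N -> (forall i j, commute (e i) (e j)) -> coboundary w ->
  alternation w e = 0.
Proof. by case: m w e => // m w e _ comm_e [b ->]; exact: alternation_cobd. Qed.

(** By [cobd_cons] and [alternation_cobd], for every h the alternation of w is
    the sum over i of F_i (h e_i) - F_i h, where F_i collects the tuples whose
    first entry is e_i. Boundedness of w in its first entry bounds each F_i,
    so [bounded_drift] forces the alternation to vanish. *)
Lemma one_bounded_alternation (G : groupType) (R : realType) m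
    (w : cochain G R m) (e : 'I_m -> G) :
  (0 < m)%N -> (forall i j, commute (e i) (e j)) ->
  cobd w = 0 -> one_bounded w -> alternation w e = 0.
Proof.
case: m w e => // m w e _ comm_e w0 wb.
pose tl (s : 'S_m.+1) := e \o s \o lift ord0.
have /choice[M MP] (s : 'S_m.+1) :
    exists M, forall h, `|w (tuple_cons h (tl s))| <= M.
  have [M MP] := wb (tuple_cons 1%g (tl s)); exists M => h; apply: MP => j.
  case: (unliftP ord0 j) => [k ->|-> //] _; by rewrite !tuple_consS.
pose F i h :=
  \sum_(s : 'S_m.+1 | s ord0 == i) (-1) ^+ s * w (tuple_cons h (tl s)).
apply/eqP; rewrite -normr_le0.
apply: (@bounded_drift _ _ _ e F (\sum_s M s)) => // [i h|h].
  apply: le_trans (ler_norm_sum _ _ _) _.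
  rewrite [leRHS](bigID (fun s : 'S_m.+1 => s ord0 == i)) /= -[leLHS]addr0.
  apply: lerD; first by apply: ler_sum => s _; rewrite normrMsign.
  by apply: sumr_ge0 => s _; apply: le_trans (MP s 1%g).
rewrite normr_le0 subr_eq0; apply/eqP.
have wE (s : 'S_m.+1) : w (e \o s) =
    (w (tuple_cons (h * e (s ord0))%g (tl s)) - w (tuple_cons h (tl s)))
    + cobd (fun g => w (tuple_cons h g)) (e \o s).
  have := cobd_cons _ _ _ w h (e \o s).
  have -> : cobd w (tuple_cons h (e \o s)) = 0 by rewrite w0.
  rewrite -/(tl s) /= => /esym/eqP; rewrite subr_eq0 => /eqP <-.
  by rewrite addrACA addNr addr0 addrC subrK.
rewrite /alternation; under eq_bigr do rewrite wE mulrDr.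
rewrite big_split /= [X in _ + X](alternation_cobd _ _ _ _ _ comm_e) addr0.
rewrite (partition_big (fun s : 'S_m.+1 => s ord0) xpredT) //=.
apply: eq_bigr => i _; rewrite /F -sumrB; apply: eq_bigr => s /eqP <-.
by rewrite -mulrBr.
Qed.

(** * Cup powers and a Pfaffian *)

Lemma block_subproof n m (k : 'I_n) (b : 'I_m) : (k * m + b < n * m)%N.
Proof. have := ltn_ord k; have := ltn_ord b; nia. Qed.

Definition block {n m : nat} (k : 'I_n) (b : 'I_m) : 'I_(n * m) :=
  Ordinal (block_subproof n m k b).

Lemma block_inj n m (k l : 'I_n) (a b : 'I_m) :
  block k a = block l b -> k = l /\ a = b.
Proof.
have m0 : (0 < m)%N by case: m a {b} => // -[].
have e (x : 'I_n) (c : 'I_m) :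
    ((x * m + c) %/ m = x)%N /\ ((x * m + c) %% m = c)%N.
  by rewrite divnMDl // modnMDl divn_small ?modn_small ?addn0.
move=> /(congr1 val) /= kl; split; apply: val_inj => /=.
  by rewrite -(e k a).1 kl (e l b).1.
by rewrite -(e k a).2 kl (e l b).2.
Qed.

Lemma blockP n m (i : 'I_(n * m)) : exists k b, i = block k b :> 'I_(n * m).
Proof.
have im := ltn_ord i.
have m0 : (0 < m)%N by case: m i im => //; rewrite muln0.
have kn : (i %/ m < n)%N by rewrite ltn_divLR.
exists (Ordinal kn), (Ordinal (ltn_pmod i m0)); apply: val_inj => /=.
exact: divn_eq.
Qed.

Lemma cup_pow_class (G : groupType) (R : comNzRingType) m (w : cocycle G R m) n :
  exists W : cocycle G R (n * m), cup_pow (cohom_class w) n = cohom_class W /\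
    forall g, cocycle_cochain W g =
      \prod_(k < n) cocycle_cochain w (fun b => g (block k b)).
Proof.
elim: n => [|n [W [WE Wg]]].
  by exists (one_cocycle G R); split=> // g; rewrite big_ord0.
exists (cup_cocycle w W); split=> [|g]; first by rewrite /= WE cupE.
rewrite big_ord_recl -[LHS]/(cocycle_cochain w _ * cocycle_cochain W _) Wg.
congr (cocycle_cochain w _ * _).
  by apply/funext => b /=; congr g; apply: val_inj.
apply: eq_bigr => k _; congr (cocycle_cochain w _).
apply/funext => b /=; congr g.
by apply: val_inj; rewrite /= /bump add1n mulSn addnA.
Qed.

Definition block_tperm {n : nat} (j k : 'I_n) : 'S_(n * 2) :=
  (tperm (block j 0%R) (block k 0%R) * tperm (block j 1%R) (block k 1%R))%g.

Lemma block_tpermE n (j k l : 'I_n) (b : 'I_2) :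
  block_tperm j k (block l b) = block (tperm j k l) b.
Proof.
have ne (x y : 'I_n) (c d : 'I_2) : c != d -> block x c != block y d.
  by apply: contraNneq => /block_inj[_ ->].
have tb (c : 'I_2) : tperm (block j c) (block k c) (block l c) =
    block (tperm j k l) c.
  by case: (tpermP j k l) => [->|->|lj lk];
    rewrite ?tpermL ?tpermR ?tpermD //; apply/eqP => /block_inj[/esym].
have td (c d : 'I_2) (x : 'I_n) : c != d ->
    tperm (block j c) (block k c) (block x d) = block x d.
  by move=> cd; rewrite tpermD // ne.
rewrite /block_tperm permM.
have [->|->] : b = 0 \/ b = 1.
- by case: b => -[|[|//]] ?; [left|right]; exact: val_inj.
- by rewrite tb td.
- by rewrite td // tb.
Qed.

(** Exchanging two blocks is a product of two transpositions; this is why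
    the order of the blocks does not affect the sign in a Pfaffian. *)
Lemma odd_block_tperm n (j k : 'I_n) : odd_perm (block_tperm j k) = false.
Proof.
rewrite odd_permM !odd_tperm.
suff e (b : 'I_2) : (block j b != block k b) = (j != k) by rewrite !e addbb.
by congr (~~ _); apply/eqP/eqP => [/block_inj[]|->].
Qed.

Section Pfaffian.
Variables (R : numDomainType) (n : nat) (c : R).
Variable a : 'I_(n * 2) -> 'I_(n * 2) -> R.
Hypothesis aE : forall i j, i != j ->
  a i j = c * ((i == j.+1 :> nat)%:R - (j == i.+1 :> nat)%:R).

Definition pfaffian_term (s : 'S_(n * 2)) : R :=
  (-1) ^+ s * \prod_(k < n) a (s (block k 0)) (s (block k 1)).

Local Notation term := pfaffian_term.

Lemma pfaffian_term_block_tperm j k s : term (block_tperm j k * s)%g = term s.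
Proof.
rewrite /pfaffian_term odd_permM odd_block_tperm addFb; congr (_ * _).
rewrite [RHS](reindex_inj (@perm_inj _ (tperm j k))).
by apply: eq_bigr => l _; rewrite ![(_ * s)%g _]permM !block_tpermE.
Qed.

Lemma pfaffian_term_flip k s :
  term (tperm (block k 0%R) (block k 1%R) * s)%g = term s.
Proof.
have k01 : block k 0 != block k (1 : 'I_2) by apply/eqP => /block_inj[].
rewrite /pfaffian_term odd_permM odd_tperm k01 signr_addb expr1 mulN1r.
rewrite (bigD1 k) //= [in RHS](bigD1 k) //= !permM tpermL tpermR.
have sk : s (block k 0) != s (block k 1) by rewrite (inj_eq perm_inj).
rewrite aE; last by rewrite eq_sym.
rewrite [in RHS]aE //.
rewrite -[X in c * X]opprB !(mulrN, mulNr) opprK; congr (_ * (_ * _)).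
apply: eq_bigr => l lk; rewrite !permM !tpermD //;
  by apply/eqP => /block_inj[kl]; rewrite kl eqxx in lk.
Qed.

(** Up to block exchanges and flips inside blocks, which preserve every term,
    a permutation with a nonzero term can be normalised to the identity from
    left to right. Once the indices below 2j are fixed, move the position of
    2j to the beginning of block j. The partner of 2j must be adjacent to it,
    and 2j - 1 is already taken, so it is 2j + 1. In other words, a path with
    2n vertices has only one perfect matching. *)
Lemma pfaffian_term_uniq s : term s != 0 -> term s = term 1%g.
Proof.
suff H d j (s' : 'S_(n * 2)) : (j + d = n)%N ->
    (forall i : 'I_(n * 2), (i < j * 2)%N -> s' i = i) ->
    term s' != 0 -> term s' = term 1%g.
  by apply: (H n 0%N).
elim: d j s' => [|d IH] j {}s jd fix_s.
  move=> _; congr term; apply/permP => i; rewrite perm1 fix_s //.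
  by rewrite -(addn0 j) jd.
have jn : (j < n)%N by rewrite -jd addnS ltnS leq_addr.
pose j' := Ordinal jn.
(* the case where the position of 2j is already right: the partner is forced *)
have fix0 (s' : 'S_(n * 2)) :
    (forall i : 'I_(n * 2), (i < j * 2)%N -> s' i = i) ->
    s' (block j' 0) = block j' 0 -> term s' != 0 -> term s' = term 1%g.
  move=> fix_s' s'0 s'T; apply: (IH j.+1) => //; first by rewrite addSnnS.
  have s'1 : s' (block j' 1) = block j' 1.
    have : a (s' (block j' 0)) (s' (block j' 1)) != 0.
      apply: contra_neq s'T => a0.
      by rewrite /pfaffian_term (bigD1 j') //= a0 mul0r mulr0.
    rewrite aE ?(inj_eq perm_inj); last by apply/eqP => /block_inj[].
    rewrite s'0 => s'1; apply: val_inj => /=; rewrite addn1.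
    move: s'1; set x := s' (block j' 1%R); rewrite /= addn0 => s'1.
    have [e|xj] := eqVneq (j * 2)%N x.+1.
      have /fix_s' : (x < j * 2)%N by rewrite e.
      by move=> /perm_inj s'x; move: e; rewrite s'x /=; lia.
    apply: contra_neq_eq s'1 => xj'.
    by rewrite (negbTE xj) (negbTE xj') subrr mulr0.
  move=> i ij; have [ij'|ji] := ltnP i (j * 2)%N; first exact: fix_s'.
  have [ie|ie] : i = block j' 0 \/ i = block j' 1; last 2 first.
  - by rewrite ie.
  - by rewrite ie.
  have [->|ie] := eqVneq i (block j' 0); [by left|right].
  apply: val_inj => /=; move: ie; rewrite -(inj_eq val_inj) /=.
  by move=> /eqP; lia.
(* 2j is at position b of block k, with j <= k *)
have [k [b kb]] := blockP n 2 ((s^-1)%g (block j' 0)).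
have skb : s (block k b) = block j' 0 by rewrite -kb permKV.
have jk : (j <= k)%N.
  rewrite leqNgt; apply/negP => kj; have := fix_s (block k b).
  rewrite skb /= => e; have := ltn_ord b => b2.
  have /e /block_inj[/(congr1 val) /= jk _] : (k * 2 + b < j * 2)%N by lia.
  by rewrite jk ltnn in kj.
have fix_swap (s' : 'S_(n * 2)) :
    (forall i : 'I_(n * 2), (i < j * 2)%N -> s' i = i) ->
    s' (block k 0) = block j' 0 -> term s' != 0 -> term s' = term 1%g.
  move=> fix_s' s'0; rewrite -(pfaffian_term_block_tperm j' k s'); apply: fix0.
    move=> i ij; have [l [c' ie]] := blockP n 2 i; rewrite ie /= in ij *.
    by rewrite permM block_tpermE tpermD ?fix_s' // -(inj_eq val_inj) /=;
      apply/eqP; lia.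
  by rewrite permM block_tpermE tpermL.
have [b0|b1] : b = 0 \/ b = 1.
- by case: b {kb skb} => -[|[|//]] ?; [left|right]; exact: val_inj.
- by apply: fix_swap => //; move: skb; rewrite b0.
rewrite -(pfaffian_term_flip k s); apply: fix_swap.
  move=> i ij; rewrite permM tpermD ?fix_s //;
    by rewrite -(inj_eq val_inj) /=; apply/eqP; lia.
by rewrite permM tpermL; move: skb; rewrite b1.
Qed.

(** The sum is, up to a factor, the Pfaffian of a tridiagonal antisymmetric
    matrix. *)
Lemma pfaffian_neq0 : c != 0 -> \sum_(s : 'S_(n * 2)) term s != 0.
Proof.
move=> c0.
have T1 : term 1%g != 0.
  rewrite /pfaffian_term odd_perm1 expr0 mul1r; apply/prodf_neq0 => k _.
  rewrite !perm1 aE; last by apply/eqP => /block_inj[].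
  by rewrite /= addn0 addn1 eqxx ltn_eqF // sub0r mulrN1 oppr_eq0.
rewrite (bigID (fun s => term s != 0)) /= [X in _ + X]big1 => [|s]; last first.
  by move=> /negPn/eqP.
rewrite addr0 (eq_bigr (fun=> term 1%g)) => [|s]; last exact: pfaffian_term_uniq.
rewrite sumr_const mulrn_eq0 negb_or T1 andbT -lt0n.
by apply/card_gt0P; exists 1%g.
Qed.
End Pfaffian.

(** * Slopes and maps with disjoint supports *)

(** The boolean selects the right derivative. *)
Definition log_slope {R : realType} (b : bool) (f : R -> R) (x : R) : R :=
  log2 ((if b then @rderiv R else @lderiv R) f x).

Definition disjoint_supp {R : realType} (f g : thompson R) :=
  forall x, f x = x \/ g x = x.

Section LogSlope.
Variable R : realType.
Implicit Types (f g : thompson R) (x : R) (b : bool).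

Lemma log_slopeM b f g x :
  log_slope b (f * g)%g x = log_slope b f (g x) + log_slope b g x.
Proof.
have fP := asboolW (thompsonP f); have gP := asboolW (thompsonP g).
by case: b; [exact: rderiv_comp|exact: lderiv_comp].
Qed.

Lemma log_slope1 b x : log_slope b (1%g : thompson R) x = 0.
Proof.
by have /eqP := log_slopeM b 1%g 1%g x; rewrite mulg1 -subr_eq subrr => /eqP.
Qed.

Lemma thompsonK f : cancel f (f^-1)%g.
Proof.
move=> x; have := congr1 (fun h : thompson R => h x) (mulVg f).
by [].
Qed.

Lemma thompsonVK f : cancel (f^-1)%g f.
Proof.
move=> x; have := congr1 (fun h : thompson R => h x) (mulgV f).
by [].
Qed.

Lemma log_slopeV b f x : log_slope b (f^-1)%g (f x) = - log_slope b f x.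
Proof.
apply/eqP; rewrite -subr_eq0 opprK -log_slopeM.
by rewrite mulVg log_slope1.
Qed.

(** If g moves x then f fixes both x and g x, the latter because g moves g x
    as well; the case where f moves x is symmetric. *)
Lemma disjoint_supp_commute f g : disjoint_supp f g -> commute f g.
Proof.
move=> fg; apply: val_inj; apply/funext => x.
change (f (g x) = g (f x)).
have [gx|gx] := eqVneq (g x) x.
  have [fx|fx] := eqVneq (f x) x; first by rewrite gx fx gx.
  rewrite gx; have [ffx|->//] := fg (f x).
  by case/eqP: fx; apply: (can_inj (thompsonK f)).
have [fx|] := fg x; last by move/eqP; rewrite (negbTE gx).
rewrite fx; have [//|ggx] := fg (g x).
by case/eqP: gx; apply: (can_inj (thompsonK g)).
Qed.

(** At each point one of the two maps fixes x; the chain rule, applied to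
    f g or to g f, which are equal, needs no displaced point. *)
Lemma log_slopeM_disjoint b f g x : disjoint_supp f g ->
  log_slope b (f * g)%g x = log_slope b f x + log_slope b g x.
Proof.
move=> fg; have [fx|gx] := fg x; last by rewrite log_slopeM gx.
by rewrite (disjoint_supp_commute f g fg) log_slopeM fx addrC.
Qed.

(** For commuting maps with disjoint supports the determinant depends only on
    the slopes of f and g at x itself, and is antisymmetric in f and g. It can
    be nonzero only at a common end point of the two supports. *)
Lemma gs_sum_disjoint f g : disjoint_supp f g ->
  gs_sum f g = \sum_(x \in `]0, 1[%classic)
    (log_slope false g x * log_slope true f x
     - log_slope false f x * log_slope true g x).
Proof.
move=> fg; rewrite /gs_sum; apply: eq_fsbigr => x _; rewrite det_germ_matrix.
have E b := log_slopeM_disjoint b f g x fg.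
have -> : log2 (rderiv (f \o g) x) = log_slope true f x + log_slope true g x.
  by rewrite -(E true).
have -> : log2 (lderiv (f \o g) x) = log_slope false f x + log_slope false g x.
  by rewrite -(E false).
rewrite -/(log_slope false g x) -/(log_slope true g x).
set u := log_slope _ _ _; set v := log_slope _ _ _; set w := log_slope _ _ _.
set y := log_slope _ _ _; ring.
Qed.

Lemma log_slope_id_left (f : R -> R) a x : a < x ->
  (forall y, a <= y <= x -> f y = y) -> log_slope false f x = 0.
Proof.
move=> ax fid.
rewrite /log_slope (lderiv_eq ax (s := 2 ^ 0)) ?log2_exprz // => y yx.
by rewrite expr0z mul1r !fid ?subrKC // lexx (ltW ax).
Qed.

Lemma log_slope_id_right (f : R -> R) x (a : R) : x < a ->
  (forall y, x <= y <= a -> f y = y) -> log_slope true f x = 0.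
Proof.
move=> xa fid.
rewrite /log_slope (rderiv_eq xa (s := 2 ^ 0)) ?log2_exprz // => y yx.
by rewrite expr0z mul1r !fid ?subrKC // lexx (ltW xa).
Qed.

End LogSlope.

(** * Bumps in Thompson's group *)

Definition ramp {R : realType} (c x : R) : R := Num.max (x - c) 0.

(** The standard generator of F with slopes 1/2, 1 and 2, rescaled from [0, 1]
    to [s, s + l] and extended by the identity. Writing it with ramps makes its
    continuity immediate. *)
Definition bump {R : realType} (s l x : R) : R :=
  x - ramp s x / 2 + ramp (s + l / 2) x / 2
  + ramp (s + l * 3 / 4) x - ramp (s + l) x.

Definition bump_inv {R : realType} (s l y : R) : R :=
  y + ramp s y - ramp (s + l / 4) y
  - ramp (s + l / 2) y / 2 + ramp (s + l) y / 2.

Section Bump.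
Variables (R : realType) (s l : R) (l_gt0 : 0 < l).
Implicit Types x y : R.

Local Notation bump := (bump s l).
Local Notation bump_inv := (bump_inv s l).

Lemma rampL c x : x <= c -> ramp c x = 0.
Proof. by move=> xc; apply: max_r; rewrite subr_le0. Qed.

Lemma rampR c x : c <= x -> ramp c x = x - c.
Proof. by move=> cx; apply: max_l; rewrite subr_ge0. Qed.

Lemma bump0 x : x <= s -> bump x = x.
Proof. by have l0 := l_gt0; move=> h; rewrite /bump !rampL; lra. Qed.

Lemma bump1 x : s <= x <= s + l / 2 -> bump x = (x + s) / 2.
Proof.
have l0 := l_gt0.
by move=> /andP[h1 h2]; rewrite /bump (rampR s) ?rampL; lra.
Qed.

Lemma bump2 x : s + l / 2 <= x <= s + l * 3 / 4 -> bump x = x - l / 4.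
Proof.
have l0 := l_gt0.
move=> /andP[h1 h2]; rewrite /bump (rampR s) ?(rampR (s + l / 2)) ?rampL; lra.
Qed.

Lemma bump3 x : s + l * 3 / 4 <= x <= s + l -> bump x = 2 * x - s - l.
Proof.
have l0 := l_gt0.
by move=> /andP[h1 h2]; rewrite /bump (rampL (s + l)) ?rampR; lra.
Qed.

Lemma bump4 x : s + l <= x -> bump x = x.
Proof. by have l0 := l_gt0; move=> h; rewrite /bump !rampR; lra. Qed.

Lemma bump_inv0 x : x <= s -> bump_inv x = x.
Proof. by have l0 := l_gt0; move=> h; rewrite /bump_inv !rampL; lra. Qed.

Lemma bump_inv1 x : s <= x <= s + l / 4 -> bump_inv x = 2 * x - s.
Proof.
have l0 := l_gt0.
by move=> /andP[h1 h2]; rewrite /bump_inv (rampR s) ?rampL; lra.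
Qed.

Lemma bump_inv2 x : s + l / 4 <= x <= s + l / 2 -> bump_inv x = x + l / 4.
Proof.
have l0 := l_gt0.
move=> /andP[h1 h2].
rewrite /bump_inv (rampR s) ?(rampR (s + l / 4)) ?rampL; lra.
Qed.

Lemma bump_inv3 x : s + l / 2 <= x <= s + l -> bump_inv x = (x + s + l) / 2.
Proof.
have l0 := l_gt0.
by move=> /andP[h1 h2]; rewrite /bump_inv (rampL (s + l)) ?rampR; lra.
Qed.

Lemma bump_inv4 x : s + l <= x -> bump_inv x = x.
Proof. by have l0 := l_gt0; move=> h; rewrite /bump_inv !rampR; lra. Qed.

Lemma five_pieces (c1 c2 c3 c4 x : R) :
  [\/ x <= c1, c1 <= x <= c2, c2 <= x <= c3 | c3 <= x <= c4 \/ c4 <= x].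
Proof.
have [?|/ltW ->] := leP x c1; first by constructor 1.
have [?|/ltW ->] := leP x c2; first by constructor 2.
have [?|/ltW ->] := leP x c3; first by constructor 3.
by constructor 4; have [?|/ltW ->] := leP x c4; [left|right].
Qed.

Lemma bumpK : cancel bump bump_inv.
Proof.
have l0 := l_gt0.
move=> x.
case: (five_pieces s (s + l / 2) (s + l * 3 / 4) (s + l) x) => [h|h|h|[]h].
- by rewrite bump0 ?bump_inv0.
- rewrite bump1 // bump_inv1; lra.
- rewrite bump2 // bump_inv2; lra.
- rewrite bump3 // bump_inv3; lra.
- by rewrite bump4 ?bump_inv4.
Qed.

Lemma bump_invK : cancel bump_inv bump.
Proof.
have l0 := l_gt0.
move=> x.
case: (five_pieces s (s + l / 4) (s + l / 2) (s + l) x) => [h|h|h|[]h].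
- by rewrite bump_inv0 ?bump0.
- rewrite bump_inv1 // bump1; lra.
- rewrite bump_inv2 // bump2; lra.
- rewrite bump_inv3 // bump3; lra.
- by rewrite bump_inv4 ?bump4.
Qed.

Lemma bump_homo : {homo bump : x y / x < y}.
Proof.
have l0 := l_gt0.
move=> x y xy.
by case: (five_pieces s (s + l / 2) (s + l * 3 / 4) (s + l) x) => [h|h|h|[]h];
  case: (five_pieces s (s + l / 2) (s + l * 3 / 4) (s + l) y) => [k|k|k|[]k];
  rewrite ?(bump0 _ h) ?(bump1 _ h) ?(bump2 _ h) ?(bump3 _ h) ?(bump4 _ h)
    ?(bump0 _ k) ?(bump1 _ k) ?(bump2 _ k) ?(bump3 _ k) ?(bump4 _ k); lra.
Qed.

Lemma ramp_continuous (c : R) : continuous (ramp c).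
Proof.
move=> x; apply: (@continuous_max _ _ (fun x => x - c) (fun=> 0)).
  by apply: cvgB; [exact: cvg_id|exact: cvg_cst].
exact: cvg_cst.
Qed.

Lemma bump_continuous : continuous bump.
Proof.
move=> x.
have rc (c : R) : {for x, continuous (ramp c)} by exact: ramp_continuous.
apply: cvgB (rc _); apply: cvgD (rc _); apply: cvgD; last first.
  by apply: cvgM (rc _) (cvg_cst _).
apply: cvgB; first exact: cvg_id.
by apply: cvgM (rc _) (cvg_cst _).
Qed.

Lemma bump_inv_continuous : continuous bump_inv.
Proof.
move=> x.
have rc (c : R) : {for x, continuous (ramp c)} by exact: ramp_continuous.
apply: cvgD; last by apply: cvgM (rc _) (cvg_cst _).
apply: cvgB; last by apply: cvgM (rc _) (cvg_cst _).
by apply: cvgB (rc _); apply: cvgD (rc _); exact: cvg_id.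
Qed.

Lemma bump_pl : pl_map [:: s; s + l / 2; s + l * 3 / 4; s + l] bump.
Proof.
have l0 := l_gt0.
move=> a b ab sab.
have out c : c \in [:: s; s + l / 2; s + l * 3 / 4; s + l] -> c <= a \/ b <= c.
  by move=> /sab; rewrite in_itv /= negb_and -!leNgt => /orP.
have [bs|sa] : b <= s \/ s <= a.
  by case: (out s) => [|h|h];
    rewrite ?inE ?eqxx //; [right|left].
- exists 0, 0 => x.
  by rewrite in_itv /= => xab; rewrite bump0 ?expr0z; lra.
have [h|{}sa] : b <= s + l / 2 \/ s + l / 2 <= a.
  by case: (out (s + l / 2)) => [|h|h];
    rewrite ?inE ?eqxx ?orbT //; [right|left].
- exists (-1), (s / 2) => x.
  by rewrite in_itv /= => xab; rewrite bump1 ?exprN1; lra.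
have [h|{}sa] : b <= s + l * 3 / 4 \/ s + l * 3 / 4 <= a.
  by case: (out (s + l * 3 / 4)) => [|h|h];
    rewrite ?inE ?eqxx ?orbT //; [right|left].
- exists 0, (- (l / 4)) => x.
  by rewrite in_itv /= => xab; rewrite bump2 ?expr0z; lra.
have [h|{}sa] : b <= s + l \/ s + l <= a.
  by case: (out (s + l)) => [|h|h];
    rewrite ?inE ?eqxx ?orbT //; [right|left].
- exists 1, (- (s + l)) => x.
  by rewrite in_itv /= => xab; rewrite bump3 ?expr1z; lra.
exists 0, 0 => x; rewrite in_itv /= => xab; rewrite bump4 ?expr0z; lra.
Qed.

Lemma bump_exists : dyadic s -> dyadic l -> 0 <= s -> s + l <= 1 ->
  exists f : thompson R,
    [/\ forall x, x \notin `]s, s + l[ -> f x = x,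
        f (s + l * 3 / 4) = s + l / 2,
        log_slope false f (s + l) = 1 & log_slope true f s = -1].
Proof.
have l0 := l_gt0.
move=> sd ld s0 sl1.
have sldyadic (k : int) : dyadic (s + 2 ^ k * l) by apply/dyadicD/dyadicZ.
have bumpP : thompson_map bump.
  split.
  - exists bump_inv; split; [exact: bumpK | exact: bump_invK | |].
      exact: bump_continuous.
    exact: bump_inv_continuous.
  - exact: bump_homo.
  - move=> x; rewrite in_itv /= negb_and -!ltNge => /orP[x0|x1].
      by rewrite bump0; lra.
    by rewrite bump4; lra.
  - exists [:: s; s + l / 2; s + l * 3 / 4; s + l]; last exact: bump_pl.
    move=> c; rewrite !inE => /or4P[]/eqP ->.
    + exact: sd.
    + by have := sldyadic (-1); rewrite exprN1 mulrC.
    + have -> : s + l * 3 / 4 = s + 2 ^ (-1) * l + 2 ^ (-2) * l.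
        by rewrite -!exprnN expr1; field.
      by apply/dyadicD/dyadicZ.
    + by have := sldyadic 0; rewrite expr0z mul1r.
exists (Thompson (asboolT bumpP)); split=> /=.
- move=> x; rewrite in_itv /= negb_and -!leNgt => /orP[xs|xs].
    exact: bump0.
  exact: bump4.
- rewrite bump2; lra.
- rewrite /log_slope (@lderiv_eq _ _ _ (s + l * 3 / 4) (2 ^ 1)) ?log2_exprz //.
    lra.
  move=> y yl; rewrite expr1z !bump3; lra.
- rewrite /log_slope (@rderiv_eq _ _ _ (s + l / 2) (2 ^ (-1))) ?log2_exprz //.
    lra.
  move=> y yl; rewrite exprN1 !bump1; lra.
Qed.

End Bump.

(** * Chains of commutators *)

Section Chain.
Variables (R : realType) (m : nat) (s : nat -> R) (beta : 'I_m -> thompson R)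
  (t : thompson R).
Hypotheses (s_incr : forall k, s k < s k.+1) (s_gt : forall k, 1 / 2 < s k)
  (s_le : s m <= 3 / 4) (t_le : t (3 / 4) = 1 / 2)
  (beta_fix : forall (i : 'I_m) x, x \notin `]s i, s i.+1[ -> beta i x = x)
  (beta_left : forall i : 'I_m, log_slope false (beta i) (s i.+1) = 1)
  (beta_right : forall i : 'I_m, log_slope true (beta i) (s i) = -1).
Implicit Types (i j : 'I_m) (x : R) (b : bool).

(** Being a commutator puts this element in F', although beta i alone is only
    in F: it is the inverse of beta i together with a copy of beta i, conjugated
    by t and hence carried by a disjoint interval. *)
Definition chain_elt i : thompson R := [~ beta i, t]%g.

Lemma node_ltE k k' : (s k < s k') = (k < k')%N.
Proof. exact: (leW_mono (Order.NatMonotonyTheory.incnP s_incr)). Qed.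

Lemma node_leE k k' : (s k <= s k') = (k <= k')%N.
Proof. exact: (Order.NatMonotonyTheory.incnP s_incr). Qed.

Lemma node_eqE k k' : (s k == s k') = (k == k').
Proof. by rewrite eq_le !node_leE eqn_leq. Qed.

Lemma shift_homo : {homo t : x y / x <= y}.
Proof.
by have [_ /ltW_homo h _ _] := asboolW (thompsonP t); exact: h.
Qed.

Lemma shift_lt_node x k : (k <= m)%N -> x <= s k -> t x < s 0%N.
Proof.
move=> km xk; apply: le_lt_trans (s_gt 0%N); rewrite -t_le; apply: shift_homo.
by apply: le_trans xk (le_trans _ s_le); rewrite node_leE.
Qed.

Lemma beta_slope_left i x : x \notin `]s i, s i.+1[ ->
  log_slope false (beta i) x = (x == s i.+1)%:R.
Proof.
rewrite in_itv /= negb_and -!leNgt.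
have [->|xne] := eqVneq x; first by rewrite beta_left.
case/orP=> [xs|]; last rewrite le_eqVlt eq_sym (negbTE xne) /= => sx.
  apply: (@log_slope_id_left _ _ (x - 1)); first by rewrite ltrBlDr ltrDl.
  move=> y /andP[_ yx]; apply: beta_fix.
  by rewrite in_itv /= negb_and -!leNgt (le_trans yx xs).
apply: (@log_slope_id_left _ _ (s i.+1)) => // y /andP[sy _]; apply: beta_fix.
by rewrite in_itv /= negb_and -!leNgt sy orbT.
Qed.

Lemma beta_slope_right i x : x \notin `]s i, s i.+1[ ->
  log_slope true (beta i) x = - (x == s i)%:R.
Proof.
rewrite in_itv /= negb_and -!leNgt.
have [->|xne] := eqVneq x; first by rewrite beta_right.
rewrite oppr0 orbC.
case/orP=> [sx|]; last rewrite le_eqVlt (negbTE xne) /= => xs.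
  apply: (@log_slope_id_right _ _ _ (x + 1)); first by rewrite ltrDl.
  move=> y /andP[xy _]; apply: beta_fix.
  by rewrite in_itv /= negb_and -!leNgt (le_trans sx xy) orbT.
apply: (@log_slope_id_right _ _ _ (s i)) => // y /andP[_ ys]; apply: beta_fix.
by rewrite in_itv /= negb_and -!leNgt ys.
Qed.

(** The two open intervals outside which [chain_elt i] is the identity: the
    i-th interval of the chain and its preimage under t. *)
Definition moved i : {pred R} :=
  [pred x | (x \in `]s i, s i.+1[) || (t x \in `]s i, s i.+1[)].

Lemma movedE i x :
  (x \in moved i) = (x \in `]s i, s i.+1[) || (t x \in `]s i, s i.+1[).
Proof. by []. Qed.

Lemma chain_elt_fix i x : x \notin moved i -> chain_elt i x = x.
Proof.
rewrite movedE negb_or => /andP[xi txi].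
change ((beta i)^-1%g ((t^-1)%g (beta i (t x))) = x).
by rewrite beta_fix // thompsonK -{1}(beta_fix i x xi) thompsonK.
Qed.

Lemma chain_elt_slope b i x : x \notin moved i ->
  log_slope b (chain_elt i) x =
    log_slope b (beta i) (t x) - log_slope b (beta i) x.
Proof.
rewrite movedE negb_or => /andP[xi txi].
rewrite /chain_elt /commg /conjg !log_slopeM.
change ((t^-1 * (beta i * t))%g x) with ((t^-1)%g (beta i (t x))).
change ((beta i * t)%g x) with (beta i (t x)).
rewrite (beta_fix i _ txi) thompsonK log_slopeV -{1}(beta_fix i x xi).
rewrite log_slopeV.
by rewrite addrC [X in X - _]addrC addrK.
Qed.

(** The copy contributes the slopes of beta i read at t x, and the inverse of
    beta i contributes their opposites at x. *)
Lemma chain_slope_left i x : x \notin moved i ->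
  log_slope false (chain_elt i) x = (t x == s i.+1)%:R - (x == s i.+1)%:R.
Proof.
move=> xi; rewrite chain_elt_slope //.
move: xi; rewrite movedE negb_or => /andP[? ?].
by rewrite !beta_slope_left.
Qed.

Lemma chain_slope_right i x : x \notin moved i ->
  log_slope true (chain_elt i) x = (x == s i)%:R - (t x == s i)%:R.
Proof.
move=> xi; rewrite chain_elt_slope //.
move: xi; rewrite movedE negb_or => /andP[? ?].
by rewrite !beta_slope_right // opprK addrC.
Qed.

Lemma itv_off i j x k : i != j -> x \in `]s i, s i.+1[ ->
  (x \notin `]s j, s j.+1[) /\ x != s k.
Proof.
rewrite !in_itv /= => ij /andP[ix xi]; split; last first.
  apply: contraTneq xi => xk; move: ix; rewrite xk node_ltE => ik.
  by rewrite node_ltE -leqNgt.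
apply/negP => /andP[jx xj].
have := lt_trans ix xj; have := lt_trans jx xi.
rewrite !node_ltE !ltnS => ji ij'.
by case/eqP: ij; apply/val_inj/eqP; rewrite eqn_leq ij' ji.
Qed.

Lemma shift_neq_node k k' x : (k <= m)%N -> x <= s k -> t x != s k'.
Proof.
move=> km /(shift_lt_node x k km) tx; rewrite lt_eqF //.
apply: lt_le_trans tx _.
by rewrite node_leE.
Qed.

Lemma shift_notin_itv k i x :
  (k <= m)%N -> x <= s k -> t x \notin `]s i, s i.+1[.
Proof.
move=> km /(shift_lt_node x k km) tx; rewrite in_itv /= ltNge ltW //.
by apply: lt_le_trans tx _; rewrite node_leE.
Qed.

Lemma moved_off i j x k : i != j -> (k <= m)%N -> x \in moved i ->
  [/\ x \notin moved j, x != s k & t x != s k].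
Proof.
move=> ij km; rewrite !movedE => /orP[xi|txi].
  have [xj xk] := itv_off i j x k ij xi.
  have xi' : x <= s i.+1 by move: xi; rewrite in_itv /= => /andP[_ /ltW].
  have im := ltn_ord i.
  by split; rewrite ?negb_or ?xj ?(shift_notin_itv i.+1) ?(shift_neq_node i.+1).
have [txj txk] := itv_off i j (t x) k ij txi.
have off k' : (k' <= m)%N -> ~~ (x <= s k').
  by move=> k'm; apply: contraL txi => xk'; apply: (shift_notin_itv k').
split=> //; last by apply/negP => /eqP xk; have := off k km; rewrite xk lexx.
rewrite negb_or txj andbT; apply/negP; rewrite in_itv /= => /andP[_ /ltW].
by apply/negP/off.
Qed.

Lemma chain_disjoint i j : i != j -> disjoint_supp (chain_elt i) (chain_elt j).
Proof.
move=> ij x.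
have [/(moved_off i j x 0%N ij isT)[xj _ _]|xi] := boolP (x \in moved i).
  by right; exact: chain_elt_fix.
by left; exact: chain_elt_fix.
Qed.

(** The indicator of the two points where consecutive supports meet at the
    k-th node, one in the chain and one in its copy. *)
Definition over_node k x : R := (x == s k)%:R + (t x == s k)%:R.

(** A left slope of element i and a right slope of element j can both be
    nonzero only where the support of i ends and that of j begins, that is
    at the common node of consecutive intervals or at its copy. The slopes of
    the copy are opposite to those of the chain, so the two products have the
    same sign and do not cancel in the Ghys-Sergiescu sum. *)
Lemma chain_slope_product i j x : i != j ->
  log_slope false (chain_elt i) x * log_slope true (chain_elt j) x =
    - (j == i.+1 :> nat)%:R * over_node j x.
Proof.
move=> ij; have im := ltn_ord i.
rewrite /over_node.
have [xi|xi] := boolP (x \in moved i).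
  have [xj /negbTE xs /negbTE txs] :=
    moved_off i j x j ij (ltnW (ltn_ord j)) xi.
  by rewrite (chain_slope_right j) // xs txs subrr addr0 !mulr0.
rewrite (chain_slope_left i) //.
have [xj|xj] := boolP (x \in moved j).
  have ji : j != i by rewrite eq_sym.
  have [_ /negbTE xs /negbTE txs] := moved_off j i x i.+1 ji (ltn_ord i) xj.
  rewrite xs txs subrr mul0r; case: eqP => [->|]; last by rewrite oppr0 mul0r.
  by rewrite xs txs addr0 mulr0.
rewrite (chain_slope_right j) //.
have [->|ne] := eqVneq (j : nat) i.+1.
  have [e|xs] := eqVneq x (s i.+1).
    have txs : t x != s i.+1 by apply: (shift_neq_node i.+1); rewrite ?e.
    rewrite (negbTE txs) /=; ring.
  by case: (t x == _) => /=; ring.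
rewrite oppr0 mul0r; apply/eqP; rewrite mulf_eq0 !subr_eq0.
have [->|xs] := eqVneq x (s i.+1).
  have txj : t (s i.+1) != s j by exact: (shift_neq_node i.+1).
  by rewrite (negbTE txj) [s i.+1 == s j]eq_sym node_eqE (negbTE ne) eqxx orbT.
have [txi|txs] := eqVneq (t x) (s i.+1); last by rewrite eqxx.
rewrite txi [s i.+1 == s j]eq_sym node_eqE (negbTE ne).
have [xj'|_] := eqVneq x (s j); last by rewrite eqxx orbT.
have : t x != s i.+1 by apply: (shift_neq_node j); rewrite ?xj' // ltnW.
by rewrite txi eqxx.
Qed.

Lemma sum_over_node k (u : R) : (k <= m)%N ->
  \sum_(x \in `]0, 1[%classic) (u * over_node k x) = u * 2.
Proof.
move=> km; have tP := asboolW (thompsonP t).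
have tVP := asboolW (thompsonP (t^-1)%g).
have s01 : 0 < s k < 1.
  have := s_gt k; have : s k <= 3 / 4 by apply: le_trans s_le; rewrite node_leE.
  by move=> h1 h2; apply/andP; split; lra.
have tsk : t (s k) != s k by exact: (shift_neq_node k).
have tVsk : (t^-1)%g (s k) != s k.
  by apply: contra_neq tsk => e; rewrite -{1}e thompsonVK.
rewrite (@fsbigE _ _ _ _ _ [:: s k; (t^-1)%g (s k)]) /=.
- rewrite big_cons big_cons big_nil.
  rewrite !mem_set /=; last 2 first.
  + by rewrite in_itv /=; exact: thompson_map_itv.
  + by rewrite in_itv.
  by rewrite /over_node thompsonVK (negbTE tsk) (negbTE tVsk) !eqxx /=; ring.
- by rewrite inE andbT eq_sym.
- move=> x; rewrite /= !inE => /orP[]/eqP ->; first exact: s01.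
  exact: thompson_map_itv tVP s01.
- move=> x _; rewrite !inE negb_or => /andP[xs xt].
  rewrite /over_node (negbTE xs) (_ : t x == s k = false) ?addr0 ?mulr0 //.
  by apply: contra_neqF xt => /eqP <-; rewrite thompsonK.
Qed.

Lemma gs_sum_chain i j : i != j ->
  gs_sum (chain_elt i) (chain_elt j) =
    - 2 * ((i == j.+1 :> nat)%:R - (j == i.+1 :> nat)%:R).
Proof.
move=> ij; rewrite gs_sum_disjoint; last exact: chain_disjoint.
under eq_fsbigr => x _.
  rewrite (chain_slope_product i j) // (chain_slope_product j i) 1?eq_sym //.
over.
have [e|ne] := eqVneq (i : nat) j.+1.
  rewrite (_ : j == i.+1 :> nat = false); last by rewrite e; apply/eqP; lia.
  under eq_fsbigr do rewrite oppr0 mul0r subr0.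
  by rewrite sum_over_node ?subr0; [ring|exact: ltnW].
have [e|ne'] := eqVneq (j : nat) i.+1.
  under eq_fsbigr do rewrite oppr0 mul0r sub0r -mulNr opprK.
  by rewrite sum_over_node ?sub0r; [ring|exact: ltnW].
under eq_fsbigr do rewrite oppr0 !mul0r subr0.
by rewrite fsbig1 // subrr mulr0.
Qed.

(** Left slopes at the right ends of the intervals tell the elements of the
    chain apart. *)
Lemma chain_slope_end i k : (k < m)%N ->
  chain_elt i (s k.+1) = s k.+1 /\
  log_slope false (chain_elt i) (s k.+1) = - (i == k :> nat)%:R.
Proof.
move=> km; have tsk : t (s k.+1) != s i.+1 by exact: (shift_neq_node k.+1).
have tsi : t (s k.+1) \notin `]s i, s i.+1[ by exact: (shift_notin_itv k.+1).
have ki : s k.+1 \notin moved i.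
  rewrite movedE negb_or tsi andbT in_itv /= !node_ltE !ltnS; lia.
split; first exact: chain_elt_fix.
by rewrite chain_slope_left // (negbTE tsk) node_eqE eqSS sub0r eq_sym.
Qed.

End Chain.

(** The chain lies strictly between 1/2 and 3/4, and the map t on [0, 1] sends
    3/4 to 1/2, so it pushes the chain off itself. *)
Lemma chain_exists (R : realType) (m : nat) :
  exists (e : 'I_m -> derived (thompson R)) (p : 'I_m -> R),
    [/\ forall i j, commute (e i) (e j),
        forall i j, i != j -> gs_sum (derived_val (e i)) (derived_val (e j)) =
          - 2 * ((i == j.+1 :> nat)%:R - (j == i.+1 :> nat)%:R) &
        forall i k, derived_val (e i) (p k) = p k /\
          log_slope false (derived_val (e i)) (p k) = - (i == k)%:R].
Proof.
(* m + 1 intervals of this length fit between 1/2 and 3/4 *)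
pose l : R := 1 / 2 ^+ (m + 3).
have l0 : 0 < l by rewrite divr_gt0 ?exprn_gt0.
pose s (k : nat) : R := 1 / 2 + k.+1%:R * l.
have sS k : s k.+1 = s k + l.
  by rewrite /s -[k.+2%:R]natr1 mulrDl (mul1r l) addrA.
have s_incr k : s k < s k.+1 by rewrite sS ltrDl.
have s_gt k : 1 / 2 < s k by rewrite /s ltrDl mulr_gt0 // ltr0n.
have s_le : s m <= 3 / 4.
  suff h : m.+1%:R * l <= 1 / 4 by rewrite /s; lra.
  rewrite /l mulrA mulr1 ler_pdivrMr ?exprn_gt0 // exprD.
  have : m.+1%:R <= 2 ^+ m :> R by rewrite -natrX ler_nat ltn_expl.
  have -> : 2 ^+ 3 = 8 :> R by rewrite -natrX.
  have : 0 <= m.+1%:R :> R by [].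
  set u := m.+1%:R; set v := 2 ^+ m => u0 uv; lra.
have s_dyadic k : dyadic (s k).
  apply: dyadicD; first by exists 1, 1%N; rewrite expr1.
  by exists k.+1%:Z, (m + 3)%N; rewrite /l mulrA mulr1.
have l_dyadic : dyadic l by exists 1, (m + 3)%N.
have dyadic0 : @dyadic R 0 by exists 0, 0%N; rewrite mul0r.
have dyadic1 : @dyadic R 1 by exists 1, 0%N; rewrite expr0 divr1.
have le01 : 0 + 1 <= 1 :> R by rewrite add0r.
have [t [_ t34 _ _]] := bump_exists R 0 1 ltr01 dyadic0 dyadic1 (lexx 0) le01.
have t_le : t (3 / 4) = 1 / 2 by move: t34; rewrite !add0r !mul1r.
have /choice[beta betaP] (i : 'I_m) : exists f : thompson R,
    [/\ forall x, x \notin `]s i, s i.+1[ -> f x = x,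
        log_slope false f (s i.+1) = 1 & log_slope true f (s i) = -1].
  have si : s i.+1 <= s m.
    by rewrite (Order.NatMonotonyTheory.incnP s_incr).
  have s0 := s_gt i.
  have si0 : 0 <= s i by lra.
  have si1 : s i + l <= 1 by rewrite -sS; lra.
  have := bump_exists R (s i) l l0 (s_dyadic i) l_dyadic si0 si1.
  by rewrite -sS => -[f [f1 _ f2 f3]]; exists f.
have fixb (i : 'I_m) x : x \notin `]s i, s i.+1[ -> beta i x = x.
  by case: (betaP i) => + _ _; apply.
have leftb (i : 'I_m) : log_slope false (beta i) (s i.+1) = 1.
  by case: (betaP i).
have rightb (i : 'I_m) : log_slope true (beta i) (s i) = -1 by case: (betaP i).
have der (i : 'I_m) : commutator_subgroup (chain_elt R m beta t i).
  by apply/asboolP => S _; apply.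
exists (fun i => Derived (der i)), (fun k => s k.+1); split=> /=.
- move=> i j; apply: val_inj => /=.
  have [->//|ij] := eqVneq i j.
  apply: disjoint_supp_commute.
  exact: (chain_disjoint R m s beta t).
- move=> i j ij; exact: (gs_sum_chain R m s beta t).
- by move=> i k; apply: (chain_slope_end R m s beta t).
Qed.

(** * Homomorphisms from free abelian groups *)

Definition zexpg {G : groupType} (x : G) (k : int) : G :=
  match k with Posz n => (x ^+ n)%g | Negz n => (x ^- n.+1)%g end.

Lemma zexpgS (G : groupType) (x : G) k : zexpg x (k + 1) = (zexpg x k * x)%g.
Proof.
case: k => n; first by rewrite -PoszD addn1 /= expgSr.
rewrite NegzE; case: n => [|n].
  by rewrite addNr /= expg0 expg1 mulVg.
have -> : - n.+2%:Z + 1 = Negz n by rewrite NegzE; lia.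
by rewrite -NegzE /= [(x ^+ n.+2)%g]expgS invgM mulgVK.
Qed.

Lemma zexpgD (G : groupType) (x : G) j k :
  zexpg x (j + k) = (zexpg x j * zexpg x k)%g.
Proof.
have pred i : zexpg x (i - 1) = (zexpg x i * x^-1)%g.
  by rewrite -{2}(subrK 1 i) zexpgS mulgK.
elim/int_rect: k => [|n IH|n IH]; first by rewrite addr0 /= expg0 mulg1.
  by rewrite intS [1 + _]addrC addrA !zexpgS IH mulgA.
by rewrite intS opprD [- 1 + _]addrC addrA !pred IH mulgA.
Qed.

Lemma commute_zexpg (G : groupType) (x y : G) j k :
  commute x y -> commute (zexpg x j) (zexpg y k).
Proof.
move=> xy.
have half (u v : G) (i : int) : commute u v -> commute u (zexpg v i).
  by move=> uv; case: i => n; [|apply: commuteV]; exact: commuteX.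
exact: (half _ _ _ (commute_sym (half _ _ _ (commute_sym xy)))).
Qed.

Definition zprod {G : groupType} {m : nat} (e : 'I_m -> G)
    (v : Algebra.to_multiplicative 'rV[int]_m) : G :=
  (\prod_(i < m) zexpg (e i) ((v : 'rV[int]_m) ord0 i))%g.

Lemma zprodM (G : groupType) m (e : 'I_m -> G) :
  (forall i j, commute (e i) (e j)) -> {morph zprod e : u v / (u * v)%g}.
Proof.
move=> comm_e u v; rewrite /zprod -prodgM_commute => [|i j _ _]; last first.
  exact: commute_zexpg.
apply: eq_bigr => i _; rewrite -zexpgD.
by have -> : (u * v)%g = (u : 'rV[int]_m) + v by []; rewrite mxE.
Qed.

Lemma zprod_delta (G : groupType) m (e : 'I_m -> G) i :
  zprod e (delta_mx ord0 i) = e i.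
Proof.
rewrite /zprod (@big_only1 _ _ _ _ i) // => [|j ji _].
  by rewrite mxE !eqxx /= expg1.
by rewrite mxE eqxx (negbTE ji).
Qed.

(** On the maps fixing p the logarithm of the left slope at p is a
    homomorphism. *)
Lemma zprod_slope (R : realType) m (e : 'I_m -> derived (thompson R)) (p : R)
    (c : 'I_m -> R) v :
  (forall i, derived_val (e i) p = p /\
             log_slope false (derived_val (e i)) p = c i) ->
  log_slope false (derived_val (zprod e v)) p =
    \sum_i ((v : 'rV[int]_m) ord0 i)%:~R * c i.
Proof.
move=> ep.
pose P (x : derived (thompson R)) (a : R) :=
  derived_val x p = p /\ log_slope false (derived_val x) p = a.
have P1 : P 1%g 0 by split=> //; exact: log_slope1.
have PM x y a b : P x a -> P y b -> P (x * y)%g (a + b).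
  move=> [xp xa] [yp yb]; split.
    by change (derived_val x (derived_val y p) = p); rewrite yp.
  by rewrite [log_slope _ _ _]log_slopeM yp xa yb.
have PV x a : P x a -> P (x^-1)%g (- a).
  move=> [xp xa]; have xK := thompsonK R (derived_val x).
  split; first by rewrite -{1}xp; exact: xK.
  by rewrite -{1}xp -xa; exact: log_slopeV.
have PX x a n : P x a -> P (x ^+ n)%g (n%:R * a).
  move=> xa; elim: n => [|n IH]; first by rewrite mul0r.
  by rewrite expgS -natr1 mulrDl mul1r addrC; exact: PM.
suff [] : P (zprod e v) (\sum_i ((v : 'rV[int]_m) ord0 i)%:~R * c i) by [].
rewrite /zprod; elim/big_ind2 : _ => // [x a y b|i _]; first exact: PM.
case: (_ ord0 i) => n /=; first exact: PX.
by rewrite NegzE rmorphN /= mulNr; exact/PV/PX.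
Qed.

(** * Nonvanishing of the powers of the Ghys-Sergiescu class *)

Theorem proposition7p1 (R : realType) (n : nat) (n_gt0 : (0 < n)%N) :
  (exists psi : {multiplicative
      Algebra.to_multiplicative 'rV[int]_(n * 2) -> derived (thompson R)},
    injective psi /\ pullback psi (cup_pow (gs_class R) n) != 0) /\
  ~ (exists w : cocycle (derived (thompson R)) R (n * 2),
    one_bounded w /\ cohom_class w = cup_pow (gs_class R) n).
Proof.
have [e [p [comm_e gs_e slope_e]]] := chain_exists R (n * 2).
pose psiM := isMultiplicative.Build _ _ (zprod e) (zprodM _ _ e comm_e).
pose psi : {multiplicative _ -> _} := HB.pack (zprod e) psiM.
have psi_inj : injective psi.
  move=> u v uv; apply/rowP => k.
  have slope_psi w : log_slope false (derived_val (psi w)) (p k) =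
      - ((w : 'rV[int]_(n * 2)) ord0 k)%:~R.
    rewrite (zprod_slope R _ e (p k) _ w (fun i => slope_e i k)).
    rewrite (bigD1 k) //= eqxx mulrN1 big1 ?addr0 // => i /negbTE ->.
    by rewrite oppr0 mulr0.
  apply: (@intr_inj R); apply: oppr_inj.
  by rewrite -!slope_psi uv.
have [W [WE Wg]] := cup_pow_class _ _ _ (gs_cocycle R) n.
pose d i : Algebra.to_multiplicative 'rV[int]_(n * 2) := delta_mx ord0 i.
have psi_d i : psi (d i) = e i by exact: zprod_delta.
have comm_d i j : commute (d i) (d j) by exact: Algebra.commuteT.
have alt_W : alternation (pullback_cochain psi W) d != 0.
  rewrite alternation_pullback (_ : psi \o d = e); last by apply/funext.
  rewrite /alternation; under eq_bigr do rewrite Wg.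
  by apply: (pfaffian_neq0 R n (- 2)
    (fun i j => gs_sum (derived_val (e i)) (derived_val (e j)))).
have n2_gt0 : (0 < n * 2)%N by rewrite muln_gt0 n_gt0.
have alt0 w : coboundary w -> alternation (w : cochain _ R (n * 2)) d = 0.
  exact: alternation_coboundary.
split.
  exists psi; split=> //; apply: contra_neq alt_W => u0.
  rewrite /gs_class WE pullbackE in u0.
  have /cohom_class_eqP/alt0 : cohom_class (pullback_cocycle psi W) =
    cohom_class 0 by rewrite u0; apply/esym/raddf0.
  by rewrite subr0.
move=> [w [wb wE]]; case/eqP: alt_W.
have /cohom_class_eqP/(pullback_coboundary psi)/alt0 :
  cohom_class W = cohom_class w by rewrite wE -WE.
rewrite -[X in alternation X](_ :
  pullback_cochain psi W - pullback_cochain psi w = _) //.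
rewrite alternationB => /eqP; rewrite subr_eq0 => /eqP ->.
apply: one_bounded_alternation => //.
  by rewrite diff_pullback (eqP (cocycleP w)).
move=> g; have [M MP] := wb (psi \o g); exists M => h hg.
by apply: MP => j j0 /=; rewrite hg.
Qed.
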